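(* Suppose that for some $s\in(0,1)$ one has $\sum_{j\ge1}\|\kappa_j\|_{\mathcal K}^s<\infty$. Then there exists a $\frac{r+\theta}{2}$-admissible sequence $\rho=(\rho_j)_{j\ge1}$, i.e. one with $\rho_j>1$ for every $j\ge1$ and $\sum_{j\ge1}\rho_j|\kappa_j(x)|\le\kappa_0(x)-\frac{r+\theta}{2}$ for all $x\in D$, such that $$\sum_{\nu\in\mathcal F}\|t^u_\nu\|_{\mathcal V}^s<\infty\quad\text{and}\quad\sum_{\nu\in\mathcal F}\|t^p_\nu\|_{\mathcal Q}^s<\infty .$$
   Context: Spaces and forms. $D\subset\mathbb{R}^d$ is an open bounded domain; $\mathcal V,\mathcal Q$ are real Hilbert spaces with duals $\mathcal V',\mathcal Q'$; $f\in\mathcal V'$, $g\in\mathcal Q'$. $\mathcal K$ is a separable Banach space of real-valued essentially bounded functions on $D$ with $\operatorname{ess\,sup}_D|\kappa|\le\|\kappa\|_{\mathcal K}$. $b:\mathcal V\times\mathcal Q\to\mathbb R$ is bilinear, and $a(w,v;\kappa)=a_0(w,v)+a_1(w,v;\kappa)$ for $\kappa\in L^\infty(D)$, where $a_0$ and $a_1(\cdot,\cdot;\kappa)$ are bilinear on $\mathcal V\times\mathcal V$ and $a_1$ is linear in $\kappa$. Let $\mathcal V^0=\{v\in\mathcal V: b(v,q)=0\ \forall q\in\mathcal Q\}$. There are constants $c_1,C_1>0$, independent of $\kappa$, with: $a_1(v,v;\kappa)\ge c_1\operatorname{ess\,inf}_D\kappa\,\|v\|_{\mathcal V}^2$ for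 $v\in\mathcal V^0$ and $\kappa\ge0$; $a_1(w,v;\kappa)\le C_1\operatorname{ess\,sup}_D|\kappa|\,\|w\|_{\mathcal V}\|v\|_{\mathcal V}$ for all $w,v\in\mathcal V$; $a_1(w,v;\kappa)\le\frac12\big(a_1(w,w;|\kappa|)+a_1(v,v;|\kappa|)\big)$ for all $w,v\in\mathcal V$. Saddle point problem at $\kappa$: find $(u,p)\in\mathcal V\times\mathcal Q$ such that $a(u,v;\kappa)+b(v,p)=f(v)$ for all $v\in\mathcal V$ and $b(u,q)=g(q)$ for all $q\in\mathcal Q$. Well-posedness assumptions. There are $0<\theta<\Theta<\infty$ and constants $\gamma,\delta,\alpha,\beta>0$ such that for every $\kappa$ with $\theta\le\kappa(x)\le\Theta$ on $D$: $a(w,v;\kappa)\le\gamma\|w\|_{\mathcal V}\|v\|_{\mathcal V}$ for all $w,v\in\mathcal V$; $a(v,v;\kappa)\ge\alpha\|v\|_{\mathcal V}^2$ for all $v\in\mathcal V^0$; moreover $b(v,q)\le\delta\|v\|_{\mathcal V}\|q\|_{\mathcal Q}$ and $\inf_{q\in\mathcal Q}\sup_{v\in\mathcal V}\frac{b(v,q)}{\|v\|_{\mathcal V}\|q\|_{\mathcal Q}}\ge\beta$. Under these assumptions the problem has a unique solution. Affine parametrization. $U=[-1,1]^{\mathbb N}$, $\kappa(x,y)=\kappa_0(x)+\sum_{j\ge1}y_j\kappa_j(x)$ for $(x,y)\in D\times U$, with $\kappa_j\in\mathcal K$ for $j\ge0$, and $\theta<\kappa_{\min}:=\inf_{D\times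 U}\kappa\le\sup_{D\times U}\kappa=:\kappa_{\max}<\Theta/2$. $(u(y),p(y))$ denotes the solution at $\kappa=\kappa(\cdot,y)$. The number $r$ is fixed with $\theta<r<\kappa_{\min}$. Taylor coefficients. $\mathcal F$ is the set of finitely supported sequences $\nu=(\nu_j)_{j\ge1}$ of nonnegative integers; $\nu!=\prod_j\nu_j!$; $t^\psi_\nu=\frac1{\nu!}\partial^\nu\psi(0)$ for $\psi=u,p$, where $\partial^\nu$ is the mixed partial derivative in $y$ of order $\nu$. *)

(* Defs.v *)
From HB Require Import structures.
From mathcomp Require Import all_boot all_order all_algebra.
From mathcomp Require Import finmap.
From mathcomp Require Import all_classical all_reals all_analysis.
From mathcomp Require Import ess_sup_inf.

Set Implicit Arguments.
Unset Strict Implicit.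
Unset Printing Implicit Defensive.

Import Order.TTheory GRing.Theory Num.Theory.
Import numFieldNormedType.Exports.

Local Open Scope classical_set_scope.
Local Open Scope ring_scope.

Section lebesgue_outer_measure.
Context {R : realType} {d : nat}.
Local Notation T := 'rV[R]_d.+1.

Definition box (c : T * T) : set T :=
  [set x | forall i, c.1 0 i <= x 0 i < c.2 0 i].

Definition box_volume (c : T * T) : R :=
  \prod_i Num.max 0 (c.2 0 i - c.1 0 i).

Definition box_cover (A : set T) : set (nat -> T * T) :=
  [set F | A `<=` \bigcup_k box (F k)].

Definition lebesgue_outer (A : set T) : \bar R :=
  ereal_inf [set (\sum_(k <oo) (box_volume (F k))%:E)%E | F in box_cover A].

Local Open Scope ereal_scope.

Let vol (c : T * T) : \bar R := (box_volume c)%:E.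

Let vol_ge0 c : 0 <= vol c.
Proof. by rewrite lee_fin; apply: prodr_ge0 => i _; rewrite le_max lexx. Qed.

Let lebesgue_outer_ge0 A : 0 <= lebesgue_outer A.
Proof.
apply: le_ereal_inf_tmp => x [F _ <-].
by apply: nneseries_ge0 => k _ _; exact: vol_ge0.
Qed.

Let lebesgue_outer0 : lebesgue_outer set0 = 0.
Proof.
apply/eqP; rewrite eq_le lebesgue_outer_ge0 andbT.
apply: ereal_inf_lbound; exists (fun=> (0%R, 0%R)); first exact: sub0set.
apply: eseries0 => k _ _; congr EFin.
by rewrite /box_volume /= (bigD1 ord0)//= subrr maxxx mul0r.
Qed.

Let le_lebesgue_outer : {homo lebesgue_outer : A B / A `<=` B >-> A <= B}.
Proof.
move=> A B AB; apply/ereal_inf_le_tmp => x [F BF <-].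
by exists F => //; exact: subset_trans BF.
Qed.

Let lebesgue_outer_sigma_subadditive : sigma_subadditive lebesgue_outer.
Proof.
move=> A; have [[i ioo]|] := pselect (exists i, lebesgue_outer (A i) = +oo).
  rewrite (eseries_pinfty _ _ ioo) ?leey// => n _.
  by rewrite -ltNye (lt_le_trans _ (lebesgue_outer_ge0 _)).
rewrite -forallNE => Aoo.
suff add2e (e : {posnum R}) : lebesgue_outer (\bigcup_n A n) <=
    \sum_(i <oo) lebesgue_outer (A i) + e%:num%:E.
  by apply/lee_addgt0Pr => _/posnumP[].
rewrite (le_trans _ (epsilon_trick _ _ _))//.
pose P n (B : nat -> T * T) := box_cover (A n) B /\
  \sum_(k <oo) vol (B k) <= lebesgue_outer (A n) + (e%:num / (2 ^ n.+1)%:R)%:E.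
have [G PG] : {G : nat -> nat -> T * T & forall n, P n (G n)}.
  apply: (@choice _ _ P) => n; rewrite /P.
  have Sfin : lebesgue_outer (A n) \is a fin_num.
    rewrite ge0_fin_numE// ltey; apply/eqP; exact: Aoo.
  have en1 : (0 < e%:num / (2 ^ n.+1)%:R)%R by [].
  have [x [B AnB muBx] xS] := lb_ereal_inf_adherent en1 Sfin.
  by exists B; split => //; rewrite muBx; exact/ltW.
apply: (@le_trans _ _ (\esum_(i in setT) (vol \o uncurry G) i)).
  apply: ereal_inf_lbound => /=.
  have /card_esym/ppcard_eqP[f] := card_nat2.
  exists (uncurry G \o f).
    move=> t [i _ /(PG i).1[j _ Bijt]]; exists (f^-1%FUN (i, j)) => //=.
    by rewrite invK ?inE.
  rewrite -(esum_pred_image (vol \o uncurry G) _ xpredT) ?[fun=> _]set_true//.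
    by rewrite image_eq.
  by move=> *; exact: vol_ge0.
rewrite (_ : esum _ _ = \sum_(i <oo) \sum_(j <oo) vol (G i j)); last first.
  pose J : nat -> set (nat * nat) := fun i => [set (i, j) | j in setT].
  rewrite (_ : setT = \bigcup_k J k); last first.
    by rewrite predeqE => -[a b]; split => // _; exists a => //; exists b.
  rewrite esum_bigcupT /=; last 2 first.
    - apply/trivIsetP => i j _ _ ij.
      rewrite predeqE => -[n m] /=; split => //= -[] [_] _ [<-{n} _].
      by move=> [m' _] [] /esym/eqP; rewrite (negbTE ij).
    - by move=> *; exact: vol_ge0.
  rewrite -(image_id [set: nat]) -fun_true esum_pred_image//; last first.
    by move=> n _; apply: esum_ge0 => *; exact: vol_ge0.
  apply: eq_eseriesr => /= j _.
  rewrite -(esum_pred_image (vol \o uncurry G) (pair j) predT)//=; last first.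
    by move=> ? ? _ _; exact: (@can_inj _ _ _ snd).
  by congr esum; rewrite predeqE => -[a b]; split; move=> [i _ <-]; exists i.
apply: lee_lim.
- apply: is_cvg_nneseries => n *.
  by apply: nneseries_ge0 => m *; exact: vol_ge0.
- by apply: is_cvg_nneseries => n *; apply: adde_ge0.
- by near=> n; apply: lee_sum => i _; exact: (PG i).2.
Unshelve. all: by end_near. Qed.

HB.instance Definition _ := isOuterMeasure.Build R T lebesgue_outer
  lebesgue_outer0 lebesgue_outer_ge0 le_lebesgue_outer
  lebesgue_outer_sigma_subadditive.

End lebesgue_outer_measure.

(* R^(d+1) with the Lebesgue-measurable sets, which are the Caratheodory
   measurable ones; [lebesgue_outer] is a complete measure on it. *)
Definition lebesgue_space (R : realType) (d : nat) :=
  caratheodory_type (@lebesgue_outer R d).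

HB.instance Definition _ (R : realType) (d : nat) :=
  Measurable.on (lebesgue_space R d).

Definition lebesgue {R : realType} {d : nat} :
  set (lebesgue_space R d) -> \bar R := @lebesgue_outer R d.

HB.instance Definition _ (R : realType) (d : nat) :=
  isMeasure.Build _ (lebesgue_space R d) R (@lebesgue R d)
    (@caratheodory_measure0 R _ (@lebesgue_outer R d))
    (@caratheodory_measure_ge0 R _ (@lebesgue_outer R d))
    (@caratheodory_measure_sigma_additive R _ (@lebesgue_outer R d)).

Section essentially_bounded.
Context {R : realType} {d : nat}.
Implicit Types (D : set 'rV[R]_d.+1) (k : 'rV[R]_d.+1 -> R).

(* The functions are sent to -oo (resp. +oo) outside D, so that only their
   values in D count. *)
Definition ess_sup_on D k : \bar R :=
  ess_sup lebesgue (patch (cst -oo%E) D (EFin \o k)).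

Definition ess_inf_on D k : \bar R :=
  ess_inf lebesgue (patch (cst +oo%E) D (EFin \o k)).

(* Functions stand for their classes in L^oo(D). *)
Definition Linfty D k : Prop :=
  measurable_fun (D : set (lebesgue_space R d)) (k : lebesgue_space R d -> R) /\
  (ess_sup_on D (fun x => `|k x|)%R < +oo)%E.

End essentially_bounded.

Section saddle_point.
Context {R : realType} {V Q : normedModType R}.

Definition kernel_form (b : V -> Q -> R) : set V :=
  [set v | forall q, b v q = 0].

Definition inf_sup (b : V -> Q -> R) : \bar R :=
  ereal_inf [set ereal_sup [set (b v q / (`|v| * `|q|))%:E | v in [set~ 0]]
            | q in [set~ 0]].

Definition saddle_solution (a : V -> V -> R) (b : V -> Q -> R)
    (f : V -> R) (g : Q -> R) (u : V) (p : Q) : Prop :=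
  (forall v, a u v + b v p = f v) /\ (forall q, b u q = g q).

End saddle_point.

Section parametrization.
Context {R : realType}.

Definition cube : set (nat -> R) := [set y | forall j, -1 <= y j <= 1].

Definition open_cube : set (nat -> R) := [set y | forall j, -1 < y j < 1].

(* In [affine_coef k0 k], [k j] is the coefficient of the (j+1)-st parameter. *)
Definition affine_coef {T : Type} (k0 : T -> R) (k : nat -> T -> R)
    (y : nat -> R) (x : T) : R :=
  k0 x + limn (series (fun j => y j * k j x)).

Definition admissible {T : Type} (D : set T) (k0 : T -> R) (k : nat -> T -> R)
    (delta : R) (rho : nat -> R) : Prop :=
  (forall j, 1 < rho j) /\
  (forall x, D x ->
    (\sum_(0 <= j <oo) (rho j * `|k j x|)%:E <= (k0 x - delta)%:E)%E).

End parametrization.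

Notation multi_index := {fsfun nat -> nat with 0%N}.

Section taylor.
Context {R : realType} {W : normedModType R}.
Implicit Types (psi : (nat -> R) -> W) (nu : multi_index).

Definition coordinate_section psi (j : nat) (y : nat -> R) : R -> W :=
  fun t => psi [eta y with j |-> t].

Definition partial (j : nat) psi : (nat -> R) -> W :=
  fun y => derive1 (coordinate_section psi j y) (y j).

(* The derivatives in the variables of smallest index are taken last. *)
Definition mixed_partial nu psi : (nat -> R) -> W :=
  foldr (fun j => iter (nu j) (partial j)) psi (sort leq (finsupp nu)).

Definition multi_fact nu : nat := (\prod_(j <- finsupp nu) (nu j)`!)%N.

Definition taylor_coef psi nu : W :=
  (multi_fact nu)%:R^-1 *: mixed_partial nu psi (fun=> 0).

(* [derive1] is total: this states that the iterated derivatives exist. *)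
Definition has_mixed_partials psi : Prop :=
  forall nu j y, open_cube y ->
    derivable (coordinate_section (mixed_partial nu psi) j y) (y j) 1.

End taylor.

(* Main.v *)
(* Differentiating the saddle point problem shows that the Taylor coefficients
   solve saddle point problems at [kappa0], coupled to the predecessors in the
   multi-index: for [nu <> 0], [t_nu] lies in [V^0] and
     a(t_nu, v; kappa0) + b(v, tp_nu) = - sum_(j in supp nu) a1(t_(nu-e_j), v; kappa_j).
   Let [rho_j >= 0] satisfy [sum_j rho_j |kappa_j| <= kappa0 - theta].  Testing
   with [v = t_nu], weighting by [rho^(2 nu)], splitting the couplings with Young's
   inequality for [a1] and summing over a finite down-closed set of multi-indices,
   the [a1]-terms telescope and coercivity at [kappa0 - sum_j rho_j |kappa_j|]
   leaves [rho^nu |t_nu| <= M] with [M] independent of [rho]; the inf-sup condition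
   transfers the bound to [tp_nu].  Now let [rho] depend on [nu]: [rho_j = 1 + eps]
   for [j < J], and [rho_j = c nu_j / (n B_j)] for [j >= J], where
   [n = sum_(j >= J) nu_j] and [B_j] slightly exceeds [|kappa_j|_K].  As
   [n^n <= e^n n!], this bounds [|t_nu|^s] by a constant times
     (1 + eps)^(- s sum_(j < J) nu_j) * n!/prod_(j >= J) nu_j! * prod_(j >= J) D_j^nu_j,
   [D_j = (e B_j / c)^s], which is summable once [sum_(j >= J) D_j < 1].
   The admissible sequence of the statement does not enter the sums: since
   [|kappa_j| <= Theta] on [D], one may take [rho_j - 1] proportional to [2^-j]. *)

Require Import Defs.
From HB Require Import structures.
From mathcomp Require Import all_boot all_order all_algebra.
From mathcomp Require Import finmap.
From mathcomp Require Import all_classical all_reals all_analysis.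
From mathcomp Require Import ess_sup_inf measurable_realfun.
From mathcomp Require Import ring lra.

Set Implicit Arguments.
Unset Strict Implicit.
Unset Printing Implicit Defensive.

Import Order.TTheory GRing.Theory Num.Theory.
Import numFieldNormedType.Exports.

Local Open Scope classical_set_scope.
Local Open Scope ring_scope.


(** * Multi-indices *)

Definition inc_index (j : nat) (nu : multi_index) : multi_index :=
  [fsfun nu with j |-> (nu j).+1].

Definition dec_index (j : nat) (nu : multi_index) : multi_index :=
  [fsfun nu with j |-> (nu j).-1].

(** A bound on the support rather than the support itself: it passes to predecessors, one [N] serves
    a whole finite set of indices, and sums can range over [j < N]. *)
Definition supp_below (N : nat) (nu : multi_index) : Prop :=
  forall j, (N <= j)%N -> nu j = 0%N.

Definition index_zero : multi_index := [fsfun].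

Lemma inc_indexE j (nu : multi_index) i :
  inc_index j nu i = (if i == j then (nu j).+1 else nu i).
Proof. by rewrite fsfun_withE. Qed.

Lemma dec_indexE j (nu : multi_index) i :
  dec_index j nu i = (if i == j then (nu j).-1 else nu i).
Proof. by rewrite fsfun_withE. Qed.

Lemma index_zeroE j : index_zero j = 0%N.
Proof. by rewrite fsfunE. Qed.

Lemma dec_indexK j (nu : multi_index) : (0 < nu j)%N -> inc_index j (dec_index j nu) = nu.
Proof.
move=> nuj; apply/fsfunP => i; rewrite inc_indexE !dec_indexE eqxx.
by case: eqP => // ->; rewrite prednK.
Qed.

Lemma dec_inc_indexC i j (nu : multi_index) : (0 < nu i)%N ->
  dec_index i (inc_index j nu) = inc_index j (dec_index i nu).
Proof.
move=> nui; apply/fsfunP => l; rewrite !(dec_indexE, inc_indexE).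
have [ij|ij] := eqVneq i j; first by rewrite -ij; case: eqP; rewrite ?prednK.
have [->|lj] := eqVneq l j; first by rewrite eq_sym (negPf ij).
by [].
Qed.

Lemma index_eq0P (nu : multi_index) : reflect (nu = index_zero) (finsupp nu == fset0).
Proof.
apply: (iffP eqP) => [nu0|->]; last exact: finsupp0.
apply/fsfunP => j; rewrite index_zeroE; apply/eqP.
by have := mem_finsupp nu j; rewrite nu0 in_fset0 => /esym/negbFE.
Qed.

Lemma index_neq0 (nu : multi_index) : nu != index_zero -> exists j, (0 < nu j)%N.
Proof.
move=> /eqP/index_eq0P/fset0Pn[j]; rewrite mem_finsupp -lt0n => ?.
by exists j.
Qed.

Lemma index_min (nu : multi_index) : nu != index_zero ->
  exists2 i, (0 < nu i)%N & forall j, (0 < nu j)%N -> (i <= j)%N.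
Proof. by move=> /index_neq0 nu0; case: (ex_minnP nu0) => i; exists i. Qed.

Lemma index_gt0_neq0 (nu : multi_index) j : (0 < nu j)%N -> nu != index_zero.
Proof. by apply: contraTneq => ->; rewrite index_zeroE. Qed.

Lemma supp_below_finsupp N nu j :
  supp_below N nu -> j \in finsupp nu -> (j < N)%N.
Proof.
by move=> nuN; rewrite mem_finsupp ltnNge; apply: contra => /nuN ->.
Qed.

Lemma supp_below_gt0 N nu j : supp_below N nu -> (0 < nu j)%N -> (j < N)%N.
Proof. by move=> nuN nuj; rewrite ltnNge; apply: contraTN nuj => /nuN ->. Qed.

Lemma supp_belowP nu : exists N, supp_below N nu.
Proof.
exists (\max_(j <- finsupp nu) j).+1 => j jN; apply/eqP.
rewrite -[_ == _]negbK -mem_finsupp; apply/negP => jnu.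
by move: jN; rewrite ltnNge (@leq_bigmax_seq _ _ xpredT id).
Qed.

Lemma supp_below_le M N nu : (M <= N)%N -> supp_below M nu -> supp_below N nu.
Proof. by move=> MN nuM j Nj; apply: nuM; apply: leq_trans Nj. Qed.

Lemma supp_below_dec N j nu : supp_below N nu -> supp_below N (dec_index j nu).
Proof. by move=> nuN i Ni; rewrite dec_indexE; case: eqP => [<-|]; rewrite nuN. Qed.

Lemma big_finsupp (R : Type) (idx : R) (op : Monoid.com_law idx) N
    (nu : multi_index) (F : nat -> R) :
  supp_below N nu -> (forall j, nu j = 0%N -> F j = idx) ->
  \big[op/idx]_(j <- finsupp nu) F j = \big[op/idx]_(j < N) F j.
Proof.
move=> nuN F0; rewrite -(big_mkord xpredT F).
rewrite [RHS](bigID (fun j => j \in finsupp nu)) /=.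
rewrite [X in op _ X]big1 ?Monoid.mulm1; last first.
  by move=> j; rewrite mem_finsupp negbK => /eqP/F0.
rewrite -[RHS]big_filter; apply: perm_big; apply: uniq_perm.
- exact: fset_uniq.
- by rewrite filter_uniq// iota_uniq.
- move=> j; rewrite mem_filter mem_index_iota /=.
  by case: (boolP (j \in _)) => //= /(supp_below_finsupp nuN) ->.
Qed.

(** [Z] collects the coordinates other than [j], which [dec_index j] leaves alone. The recursions of
    degrees, factorials and weights are all instances. *)
Lemma big_finsupp_dec (R : Type) (idx : R) (op : Monoid.com_law idx)
    (F : nat -> nat -> R) (nu : multi_index) j :
  (forall i, F i 0%N = idx) -> (0 < nu j)%N ->
  exists2 Z, \big[op/idx]_(i <- finsupp nu) F i (nu i) = op (F j (nu j)) Z &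
    \big[op/idx]_(i <- finsupp (dec_index j nu)) F i (dec_index j nu i) =
    op (F j (nu j).-1) Z.
Proof.
move=> F0 nuj; have [N nuN] := supp_belowP nu.
have jN := supp_below_gt0 nuN nuj.
exists (\big[op/idx]_(i < N | i != Ordinal jN) F i (nu i)).
  by rewrite (big_finsupp op nuN) => [|i ->//]; rewrite (bigD1 (Ordinal jN)).
rewrite (big_finsupp op (supp_below_dec j nuN)) => [|i ->//].
rewrite (bigD1 (Ordinal jN))//= dec_indexE eqxx; congr (op _ _).
apply: eq_bigr => i ij; rewrite dec_indexE; case: eqP => // ije.
by move: ij => /eqP; case; apply: val_inj.
Qed.

Definition index_degree (nu : multi_index) : nat := (\sum_(j <- finsupp nu) nu j)%N.

Lemma index_degree_dec j (nu : multi_index) : (0 < nu j)%N ->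
  index_degree nu = (index_degree (dec_index j nu)).+1.
Proof.
move=> nuj; rewrite /index_degree.
have [//|Z -> ->] := big_finsupp_dec addn (F := fun _ n => n) _ nuj.
by rewrite -addSn prednK.
Qed.

Definition down_closed (L : {fset multi_index}) : Prop :=
  forall nu j, nu \in L -> (0 < nu j)%N -> dec_index j nu \in L.

(** Induction on the largest degree in [X]: the predecessors [Y] have smaller degree, and adding [X]
    to a down-closed set containing [Y] keeps it down-closed. *)
Lemma down_closure (X : {fset multi_index}) :
  exists2 L : {fset multi_index}, down_closed L & {subset X <= L}.
Proof.
have [n Xn] : exists n, forall nu, nu \in X -> (index_degree nu <= n)%N.
  by exists (\max_(nu <- X) index_degree nu)%N => nu nuX; rewrite leq_bigmax_seq.
elim: n X Xn => [|n IHn] X Xn.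
  exists X => // nu j nuX nuj.
  by have := Xn _ nuX; rewrite (index_degree_dec nuj).
pose Y := [fset dec_index j nu | nu in X, j in finsupp nu]%fset.
have [|L Ldown YL] := IHn Y.
  move=> _ /imfset2P[nu nuX [j jnu ->]].
  move: jnu; rewrite /= mem_finsupp -lt0n => nuj.
  by have := Xn _ nuX; rewrite (index_degree_dec nuj).
exists (X `|` L)%fset; last by move=> nu nuX; rewrite inE nuX.
move=> nu j; rewrite inE => /orP[nuX|nuL] nuj; rewrite inE; apply/orP; right.
  apply: YL; apply/imfset2P; exists nu => //; exists j => //.
  by rewrite /= mem_finsupp -lt0n.
exact: Ldown.
Qed.

Lemma fset_supp_belowP (L : {fset multi_index}) :
  exists N, forall nu, nu \in L -> supp_below N nu.
Proof.
have [N HN] := choice supp_belowP.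
exists (\max_(nu <- L) N nu)%N => nu nuL.
by apply: supp_below_le (HN nu); rewrite leq_bigmax_seq.
Qed.

Lemma ler_sum_uniq_sub (R : numDomainType) (I : eqType) (s1 s2 : seq I)
    (F : I -> R) : uniq s1 -> uniq s2 -> {subset s1 <= s2} ->
  (forall i, 0 <= F i) -> \sum_(i <- s1) F i <= \sum_(i <- s2) F i.
Proof.
move=> u1 u2 s12 F0; rewrite [leRHS](bigID (mem s1)) /=.
rewrite -[leLHS]addr0 lerD ?sumr_ge0// -[leRHS]big_filter.
rewrite (perm_big [seq i <- s2 | i \in s1])//; apply: uniq_perm => //.
  exact: filter_uniq.
by move=> i; rewrite mem_filter; case: (boolP (i \in s1)) => //= /s12 ->.
Qed.

(** [dec_index j] is injective where [nu j > 0] and maps that part of [L] into [L], so the left side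
    is a subsum of the right. *)
Lemma ler_sum_dec (R : numDomainType) (L : {fset multi_index}) j
    (P : pred multi_index) (F : multi_index -> R) :
  down_closed L -> (forall nu, 0 <= F nu) ->
  (forall nu : multi_index, P nu -> (0 < nu j)%N -> P (dec_index j nu)) ->
  \sum_(nu <- L | P nu && (0 < nu j)%N) F (dec_index j nu)
  <= \sum_(nu <- L | P nu) F nu.
Proof.
move=> Ldown F0 Pdec; rewrite -big_filter -[leRHS]big_filter.
rewrite -(big_map (dec_index j) xpredT F); apply: ler_sum_uniq_sub => //.
- rewrite map_inj_in_uniq ?filter_uniq ?fset_uniq// => mu nu.
  rewrite !mem_filter => /andP[/andP[_ muj] _] /andP[/andP[_ nuj] _] eq_dec.
  by rewrite -(dec_indexK muj) eq_dec dec_indexK.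
- by rewrite filter_uniq ?fset_uniq.
- move=> mu /mapP[nu]; rewrite !mem_filter => /andP[/andP[Pnu nuj] nuL] ->.
  by rewrite Pdec//= Ldown.
Qed.

Lemma sort_leq_cons (s : seq nat) j :
  (forall i, i \in s -> (j <= i)%N) -> sort leq (j :: s) = j :: sort leq s.
Proof.
move=> js; apply: (sorted_eq leq_trans anti_leq).
- exact: sort_sorted leq_total _.
- rewrite /= path_min_sorted ?(sort_sorted leq_total)//.
  by apply/allP => i; rewrite mem_sort => /js.
- by rewrite perm_sort perm_cons perm_sym perm_sort.
Qed.

Section mixed_partial_theory.
Context {R : realType} {W : normedModType R}.
Implicit Types (psi : (nat -> R) -> W) (nu : multi_index).

Lemma mixed_partial0 psi : mixed_partial index_zero psi = psi.
Proof. by rewrite /mixed_partial finsupp0. Qed.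

(** [mixed_partial] takes the derivative in the smallest variable last, so a derivative in a
    variable not exceeding any in the support only extends the head of the sorted list; no
    derivatives are interchanged. *)
Lemma mixed_partial_inc psi nu j :
  (forall i, (0 < nu i)%N -> (j <= i)%N) ->
  partial j (mixed_partial nu psi) = mixed_partial (inc_index j nu) psi.
Proof.
move=> jmin; apply/esym; rewrite /mixed_partial.
have supp_inc : perm_eq (finsupp (inc_index j nu)) (undup (j :: finsupp nu)).
  apply: uniq_perm; rewrite ?fset_uniq ?undup_uniq// => i.
  by rewrite mem_undup inE !mem_finsupp inc_indexE; case: (i == j).
have sup i : i \in finsupp nu -> (j <= i)%N.
  by rewrite mem_finsupp -lt0n => /jmin.
rewrite (perm_sortP leq_total leq_trans anti_leq _ _ supp_inc) /=.
have fold_eq s : j \notin s ->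
    foldr (fun i => iter (inc_index j nu i) (partial i)) psi s =
    foldr (fun i => iter (nu i) (partial i)) psi s.
  elim: s => //= i s IHs; rewrite inE negb_or => /andP[ji /IHs ->].
  by rewrite inc_indexE eq_sym (negPf ji).
have [jnu|jnu] := boolP (j \in finsupp nu); rewrite undup_id ?fset_uniq//; last first.
  rewrite sort_leq_cons//= fold_eq ?mem_sort//.
  rewrite inc_indexE eqxx; move: jnu; rewrite mem_finsupp negbK => /eqP -> //.
have nuE : perm_eq (finsupp nu) (j :: rem j (finsupp nu)) by exact: perm_to_rem.
rewrite (perm_sortP leq_total leq_trans anti_leq _ _ nuE) sort_leq_cons /=.
  rewrite fold_eq ?mem_sort ?mem_rem_uniqF ?fset_uniq//.
  by rewrite inc_indexE eqxx.
by move=> i /mem_rem/sup.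
Qed.

End mixed_partial_theory.

Lemma multi_fact_gt0 nu : (0 < multi_fact nu)%N.
Proof. by apply: prodn_gt0 => j; apply: fact_gt0. Qed.

Lemma multi_fact_dec (nu : multi_index) j : (0 < nu j)%N ->
  multi_fact nu = (nu j * multi_fact (dec_index j nu))%N.
Proof.
move=> nuj; rewrite /multi_fact.
have [//|Z -> ->] := big_finsupp_dec muln (F := fun _ n => n`!) _ nuj.
by rewrite mulnA; case: (nu j) nuj.
Qed.

(** * Stability and differentiation of saddle point problems *)

Section bilinear_for_theory.
Context {R : realType} {U W : lmodType R} (F : U -> W -> R).
Hypothesis Fbil : bilinear_for *%R *%R F.

Lemma bilinear_forPl c u u' w : F (c *: u + u') w = c * F u w + F u' w.
Proof. exact: Fbil.1. Qed.

Lemma bilinear_forPr c u w w' : F u (c *: w + w') = c * F u w + F u w'.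
Proof. exact: Fbil.2. Qed.

Lemma bilinear_forDl u u' w : F (u + u') w = F u w + F u' w.
Proof. by have := bilinear_forPl 1 u u' w; rewrite scale1r mul1r. Qed.

Lemma bilinear_forDr u w w' : F u (w + w') = F u w + F u w'.
Proof. by have := bilinear_forPr 1 u w w'; rewrite scale1r mul1r. Qed.

Lemma bilinear_for0l w : F 0 w = 0.
Proof. by apply: (addrI (F 0 w)); rewrite -bilinear_forDl !addr0. Qed.

Lemma bilinear_for0r u : F u 0 = 0.
Proof. by apply: (addrI (F u 0)); rewrite -bilinear_forDr !addr0. Qed.

Lemma bilinear_forZl c u w : F (c *: u) w = c * F u w.
Proof. by rewrite -[c *: u]addr0 bilinear_forPl bilinear_for0l !addr0. Qed.

Lemma bilinear_forZr c u w : F u (c *: w) = c * F u w.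
Proof. by rewrite -[c *: w]addr0 bilinear_forPr bilinear_for0r !addr0. Qed.

Lemma bilinear_forNl u w : F (- u) w = - F u w.
Proof. by rewrite -scaleN1r bilinear_forZl mulN1r. Qed.

Lemma bilinear_forNr u w : F u (- w) = - F u w.
Proof. by rewrite -scaleN1r bilinear_forZr mulN1r. Qed.

Lemma bilinear_forBl u u' w : F (u - u') w = F u w - F u' w.
Proof. by rewrite bilinear_forDl bilinear_forNl. Qed.

Lemma bilinear_forBr u w w' : F u (w - w') = F u w - F u w'.
Proof. by rewrite bilinear_forDr bilinear_forNr. Qed.

End bilinear_for_theory.

Lemma bilinear_for_bounded_norm (R : realType) (U W : normedModType R)
    (F : U -> W -> R) C : bilinear_for *%R *%R F ->
  (forall u w, F u w <= C * `|u| * `|w|) ->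
  forall u w, `|F u w| <= C * `|u| * `|w|.
Proof.
move=> Fbil FC u w; rewrite ler_norml FC andbT lerNl -(bilinear_forNl Fbil).
by apply: le_trans (FC _ _) _; rewrite normrN.
Qed.

Section saddle_stability.
Context {R : realType} {V Q : normedModType R} (b : V -> Q -> R).

Lemma inf_sup_le (beta M : R) (q : Q) : (beta%:E <= inf_sup b)%E -> 0 <= M ->
  (forall v, b v q <= M * `|v|) -> beta * `|q| <= M.
Proof.
move=> beta_le M0 bM; have [->|q0] := eqVneq q 0; first by rewrite normr0 mulr0.
have q_gt0 : 0 < `|q| by rewrite normr_gt0.
rewrite -ler_pdivlMr// -lee_fin; apply: le_trans beta_le _.
apply: ge_ereal_inf; exists (ereal_sup [set (b v q / (`|v| * `|q|))%:E | v in [set~ 0]]).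
  by exists q => //; exact/eqP.
apply: ub_ereal_sup => _ [v /eqP v0 <-]; rewrite lee_fin.
have v_gt0 : 0 < `|v| by rewrite normr_gt0.
by rewrite ler_pdivrMr ?mulr_gt0// [ `|v| * _]mulrC mulrA divfK ?gt_eqF.
Qed.

(** [M] plays the role of the dual norm of the right-hand side; for bilinear forms a one-sided bound
    controls the absolute value. The constraint is homogeneous because only difference quotients and
    their differences are estimated. *)
Definition saddle_stable (A : V -> V -> R) (K : R) : Prop :=
  forall (w : V) (pi : Q) (M : R), 0 <= M -> (forall q, b w q = 0) ->
    (forall v, A w v + b v pi <= M * `|v|) -> `|w| <= K * M /\ `|pi| <= K * M.

(** Testing with [w], which lies in the kernel, removes [b] and bounds [w] by coercivity; the
    inf-sup condition then bounds [pi] by [M] plus the contribution of [A w]. Adding the two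
    constants gives one that serves both. *)
Lemma coercive_saddle_stable (A : V -> V -> R) (alpha beta gamma : R) :
  0 < alpha -> 0 < beta -> 0 < gamma -> bilinear_for *%R *%R A ->
  (forall v, kernel_form b v -> alpha * `|v| ^+ 2 <= A v v) ->
  (forall w v, A w v <= gamma * `|w| * `|v|) ->
  (beta%:E <= inf_sup b)%E ->
  saddle_stable A (alpha^-1 + (1 + gamma / alpha) / beta).
Proof.
move=> alpha0 beta0 gamma0 Abil Acoer Abnd b_is w pi M M0 bw AM.
have w_le : `|w| <= M / alpha.
  have [->|w0] := eqVneq w 0; first by rewrite normr0 divr_ge0// ltW.
  have w_gt0 : 0 < `|w| by rewrite normr_gt0.
  rewrite ler_pdivlMr// mulrC -(ler_pM2r w_gt0) -mulrA -expr2.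
  by apply: le_trans (Acoer w bw) _; have := AM w; rewrite bw addr0.
have pi_le : beta * `|pi| <= M + gamma * (M / alpha).
  apply: inf_sup_le => //.
    apply: addr_ge0 => //; apply: mulr_ge0; first exact: ltW.
    by apply: divr_ge0 => //; exact: ltW.
  move=> v; have := AM v; have := Abnd (- w) v.
  rewrite (bilinear_forNl Abil) normrN => A1 A2.
  have : gamma * `|w| * `|v| <= gamma * (M / alpha) * `|v|.
    by rewrite ler_wpM2r// ler_wpM2l// ltW.
  by lra.
have K1 : 0 <= (1 + gamma / alpha) / beta * M.
  by rewrite mulr_ge0 ?divr_ge0 ?addr_ge0 ?divr_ge0 ?(ltW alpha0) ?(ltW gamma0)
    ?(ltW beta0).
have K2 : 0 <= alpha^-1 * M by rewrite mulr_ge0// invr_ge0 ltW.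
split; rewrite mulrDl.
  by apply: le_trans w_le _; rewrite mulrC lerDl.
apply: (@le_trans _ _ ((1 + gamma / alpha) / beta * M)); last by rewrite lerDr.
rewrite mulrAC ler_pdivlMr// mulrC; apply: le_trans pi_le _.
by rewrite mulrDl mul1r mulrA mulrAC.
Qed.

End saddle_stability.

(** The two-point bound makes the image filter Cauchy, and the completeness of [W] yields a limit
    that need not be known in advance. *)
Lemma cauchy_modulus_cvg (R : realType) (W : completeNormedModType R) (T : Type)
    (F : set_system T) {FF : ProperFilter F} (D : T -> W) (E : T -> R) (P : set T) :
  F P -> (forall x y, P x -> P y -> `|D x - D y| <= E x + E y) ->
  E @ F --> 0 -> cvg (D @ F).
Proof.
move=> FP DE E0; apply/cauchy_cvgP/cauchy_ballP => e e0 /=.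
have e2 : 0 < e / 2 by rewrite divr_gt0.
have : \forall x \near F, P x /\ E x < e / 2.
  near=> x; split; near: x => //.
  have /cvgrPdist_lt/(_ _ e2) := E0; apply: filterS => x.
  by rewrite sub0r normrN => /(le_lt_trans (ler_norm _)).
move=> FPE; exists (D @` [set x | P x /\ E x < e / 2], D @` [set x | P x /\ E x < e / 2]).
  by split; apply: filterS FPE => x ?; exists x.
move=> [_ _] [/= [x [Px Ex] <-] [y [Py Ey] <-]].
rewrite -ball_normE /=; apply: le_lt_trans (DE _ _ Px Py) _.
by rewrite [e]splitr ltrD.
Unshelve. all: by end_near. Qed.

Lemma cvg_derive1 (R : realType) (W : normedModType R) (f : R -> W) (a : R) (l : W) :
  (fun h => h^-1 *: (f (h + a) - f a)) @ 0^' --> l ->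
  derivable f a 1 /\ derive1 f a = l.
Proof.
move=> fl; split; last exact: cvg_lim.
rewrite /derivable.
have -> : (fun h : R => h^-1 *: ((f \o shift a) (h *: 1) - f a)) =
          (fun h => h^-1 *: (f (h + a) - f a)).
  by apply/funext => h /=; rewrite [h *: 1]mulr1.
by apply/cvg_ex; exists l.
Qed.

Lemma norm_le_cvg (R : realType) (W : normedModType R) (T : Type)
    (F : set_system T) {FF : Filter F} (f : T -> W) (l : W) (E : T -> R) :
  (\forall x \near F, `|f x - l| <= E x) -> E @ F --> 0 -> f @ F --> l.
Proof.
move=> fE E0; apply/cvgrPdist_le => e e0.
have /cvgrPdist_le/(_ _ e0) := E0.
apply: filterS2 fE => x fE Ee; rewrite distrC; apply: le_trans fE _.
by apply: le_trans (ler_norm _) _; rewrite sub0r normrN in Ee.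
Qed.

Lemma bounded_additive_cvg (R : realType) (W : normedModType R) (T : Type)
    (F : set_system T) {FF : Filter F} (D : T -> W) (l : W) (f : W -> R) (C : R) :
  (forall x y, f (x - y) = f x - f y) -> (forall x, `|f x| <= C * `|x|) ->
  D @ F --> l -> (f \o D) @ F --> f l.
Proof.
move=> fB fC Dl.
have Dl0 : (fun x => `|D x - l|) @ F --> (0 : R^o).
  by apply/norm_cvg0P; rewrite -(subrr l); apply: cvgB => //; exact: cvg_cst.
have D0 : (fun x => C * `|D x - l|) @ F --> (0 : R^o).
  by rewrite -(mulr0 C); apply: cvgM => //; exact: cvg_cst.
by apply: (@norm_le_cvg _ R^o _ _ _ _ _ _ _ D0); apply: nearW => x /=; rewrite -fB.
Qed.

Section line_derivative.
Context {R : realType} {V Q : completeNormedModType R}.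
Context (b : V -> Q -> R) (A B : V -> V -> R) (K gamma C delta : R).
Hypothesis b_bil : bilinear_for *%R *%R b.
Hypothesis A_bil : bilinear_for *%R *%R A.
Hypothesis B_bil : bilinear_for *%R *%R B.
Hypothesis K_ge0 : 0 <= K.
Hypothesis C_ge0 : 0 <= C.
Hypothesis A_bnd : forall w v, A w v <= gamma * `|w| * `|v|.
Hypothesis B_bnd : forall w v, B w v <= C * `|w| * `|v|.
Hypothesis b_bnd : forall v q, b v q <= delta * `|v| * `|q|.
Hypothesis stable : \forall h \near (0 : R),
  saddle_stable b (fun w v => A w v + h * B w v) K.

(* The solution operator is never inverted: stability makes the difference
   quotients Cauchy, and completeness provides the derivative. *)
Lemma saddle_line_derivative (t : R) (w : R -> V) (pi : R -> Q)
    (ell : R -> V -> R) (ell' : V -> R) (c : Q -> R) (e : R -> R) (L : R) :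
  (\forall h \near (0 : R), (forall v,
      A (w (h + t)) v + h * B (w (h + t)) v + b v (pi (h + t)) = ell h v) /\
      (forall q, b (w (h + t)) q = c q)) ->
  (\forall h \near 0^', forall v,
      `|h^-1 * (ell h v - ell 0 v) - ell' v| <= e h * `|v|) ->
  e @ 0^' --> 0 -> 0 <= L -> (forall v, ell' v <= L * `|v|) ->
  [/\ derivable w t 1, derivable pi t 1,
      (forall v, A (derive1 w t) v + B (w t) v + b v (derive1 pi t) = ell' v) &
      (forall q, b (derive1 w t) q = 0)].
Proof.
move=> eqs ell_diff e0 L0 ellL.
have [eq0 eq0'] : (forall v, A (w t) v + b v (pi t) = ell 0 v) /\
    (forall q, b (w t) q = c q).
  have [H1 H2] := nbhs_singleton eqs; rewrite add0r in H1 H2.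
  by split => // v; rewrite -H1 mul0r addr0.
have stable0 : saddle_stable b A K.
  have := nbhs_singleton stable.
  suff -> : (fun w v => A w v + 0 * B w v) = A by [].
  by apply/funext => x; apply/funext => y; rewrite mul0r addr0.
pose D h := h^-1 *: (w (h + t) - w t); pose P h := h^-1 *: (pi (h + t) - pi t).
(* The [1] absorbs [e h], which is eventually at most [1]; the last term accounts for [B (w t)]. *)
pose M0 := K * (L + 1 + C * `|w t|).
(* Subtracting the equations at [h + t] and [t]: the difference quotients solve a saddle point
   problem for the form perturbed by [h * B], with homogeneous constraint. *)
have near_eq : \forall h \near 0^', [/\ h != 0, (forall q, b (D h) q = 0) &
    forall v, A (D h) v + h * B (D h) v + b v (P h) =
    h^-1 * (ell h v - ell 0 v) - B (w t) v].
  near=> h.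
  have h0 : h != 0 by near: h; exact: nbhs_dnbhs_neq.
  have [H1 H2] : (forall v,
      A (w (h + t)) v + h * B (w (h + t)) v + b v (pi (h + t)) = ell h v) /\
      (forall q, b (w (h + t)) q = c q).
    by near: h; exact: nbhs_dnbhs.
  split=> // [q|v].
    by rewrite (bilinear_forZl b_bil) (bilinear_forBl b_bil) H2 eq0' subrr mulr0.
  rewrite -H1 -eq0 (bilinear_forZl A_bil) (bilinear_forZl B_bil).
  rewrite (bilinear_forZr b_bil) (bilinear_forBl A_bil) (bilinear_forBl B_bil).
  by rewrite (bilinear_forBr b_bil); field.
have near_D : \forall h \near 0^', `|D h| <= M0.
  near=> h.
  have [h0 bD eqD] : [/\ h != 0, (forall q, b (D h) q = 0) &
    forall v, A (D h) v + h * B (D h) v + b v (P h) =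
    h^-1 * (ell h v - ell 0 v) - B (w t) v] by near: h.
  have st : saddle_stable b (fun w v => A w v + h * B w v) K.
    by near: h; exact: nbhs_dnbhs.
  have ed : forall v, `|h^-1 * (ell h v - ell 0 v) - ell' v| <= e h * `|v|.
    by near: h.
  have e1 : e h <= 1.
    near: h; have /cvgrPdist_le/(_ _ ltr01) := e0.
    apply: filterS => h; rewrite sub0r normrN; exact: le_trans (ler_norm _).
  have M0' : 0 <= L + 1 + C * `|w t| by rewrite !addr_ge0 ?mulr_ge0.
  apply: (st (D h) (P h) _ M0' bD _).1 => v; rewrite eqD.
  have := ed v; rewrite ler_norml => /andP[_ H1].
  have := B_bnd (- w t) v; rewrite (bilinear_forNl B_bil) normrN => H2.
  have := ellL v; have : e h * `|v| <= 1 * `|v| by rewrite ler_wpM2r.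
  by move: H1 H2; lra.
have M0_ge0 : 0 <= M0.
  by apply: mulr_ge0 => //; apply: addr_ge0; [exact: addr_ge0|exact: mulr_ge0].
(* As [D h] is bounded by [M0], the perturbation [h * B (D h)] is small, and the quotients solve the
   unperturbed problem up to a residual [E h]. *)
pose E (h : R) : R := `|e h| + `|h| * (C * M0).
have E_ge0 h : 0 <= E h.
  by apply: addr_ge0 => //; apply: mulr_ge0 => //; exact: mulr_ge0.
have near_E : \forall h \near 0^', (forall q, b (D h) q = 0) /\
    forall v, `|A (D h) v + b v (P h) - (ell' v - B (w t) v)| <= E h * `|v|.
  near=> h.
  have [h0 bD eqD] : [/\ h != 0, (forall q, b (D h) q = 0) &
    forall v, A (D h) v + h * B (D h) v + b v (P h) =
    h^-1 * (ell h v - ell 0 v) - B (w t) v] by near: h.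
  have DM : `|D h| <= M0 by near: h.
  have ed : forall v, `|h^-1 * (ell h v - ell 0 v) - ell' v| <= e h * `|v|.
    by near: h.
  split=> // v.
  have -> : A (D h) v + b v (P h) - (ell' v - B (w t) v) =
    (h^-1 * (ell h v - ell 0 v) - ell' v) - h * B (D h) v.
    by have := eqD v; lra.
  apply: le_trans (ler_normB _ _) _; rewrite /E mulrDl lerD//.
    by apply: le_trans (ed v) _; rewrite ler_wpM2r// ler_norm.
  rewrite normrM -mulrA.
  rewrite ler_wpM2l//; apply: le_trans (bilinear_for_bounded_norm B_bil B_bnd _ _) _.
  by rewrite ler_wpM2r// ler_wpM2l.
have E0 : E @ 0^' --> (0 : R^o).
  have abs_e : (fun h => `|e h|) @ 0^' --> (0 : R^o) by exact/norm_cvg0P.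
  have abs_h : (fun h : R => `|h|) @ 0^' --> (0 : R^o).
    by apply/norm_cvg0P; exact: cvg_within.
  suff : E @ 0^' --> (0 + 0 * (C * M0) : R^o) by rewrite mul0r addr0.
  by apply: cvgD => //; apply: cvgM => //; exact: cvg_cst.
have KE0 : (fun h => K * E h) @ 0^' --> (0 : R^o).
  suff : (fun h => K * E h) @ 0^' --> (K * 0 : R^o) by rewrite mulr0.
  by apply: cvgM => //; exact: cvg_cst.
(* The difference of two quotients has residual at most [E h + E k], so the stability of [A] makes
   the quotients Cauchy. *)
have stableE h k : (forall q, b (D h) q = 0) /\
    (forall v, `|A (D h) v + b v (P h) - (ell' v - B (w t) v)| <= E h * `|v|) ->
  (forall q, b (D k) q = 0) /\
    (forall v, `|A (D k) v + b v (P k) - (ell' v - B (w t) v)| <= E k * `|v|) ->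
  `|D h - D k| <= K * E h + K * E k /\ `|P h - P k| <= K * E h + K * E k.
  move=> [bh Eh] [bk Ek]; rewrite -mulrDr.
  apply: stable0; first by rewrite addr_ge0.
    by move=> q; rewrite (bilinear_forBl b_bil) bh bk subrr.
  move=> v; rewrite (bilinear_forBl A_bil) (bilinear_forBr b_bil) mulrDl.
  have := Eh v; have := Ek v; rewrite !ler_norml => /andP[? ?] /andP[? ?].
  by lra.
have D_cvg : cvg (D @ 0^').
  by apply: (cauchy_modulus_cvg near_E _ KE0) => h k Eh Ek; exact: (stableE _ _ Eh Ek).1.
have P_cvg : cvg (P @ 0^').
  by apply: (cauchy_modulus_cvg near_E _ KE0) => h k Eh Ek; exact: (stableE _ _ Eh Ek).2.
have [w_der w'E] := cvg_derive1 D_cvg; have [pi_der pi'E] := cvg_derive1 P_cvg.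
split => // [v|q].
  rewrite w'E pi'E.
  have lim1 : (fun h => A (D h) v + b v (P h)) @ 0^' -->
      A (lim (D @ 0^')) v + b v (lim (P @ 0^')).
    apply: cvgD.
      apply: (@bounded_additive_cvg _ _ _ _ _ D _ (A^~ v) (gamma * `|v|)) => //.
        by move=> x y; rewrite (bilinear_forBl A_bil).
      by move=> x; rewrite mulrAC; exact: bilinear_for_bounded_norm.
    apply: (@bounded_additive_cvg _ _ _ _ _ P _ (b v) (delta * `|v|)) => //.
      by move=> x y; rewrite (bilinear_forBr b_bil).
    by move=> x; exact: bilinear_for_bounded_norm.
  have lim2 : (fun h => A (D h) v + b v (P h)) @ 0^' --> ell' v - B (w t) v.
    apply: (@norm_le_cvg _ R^o _ _ _ _ _ (fun h => E h * `|v|)).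
      by apply: filterS near_E => h [_]; exact.
    suff : (fun h => E h * `|v|) @ 0^' --> (0 * `|v| : R^o) by rewrite mul0r.
    by apply: cvgM => //; exact: cvg_cst.
  have := @norm_cvg_unique _ R^o _ _ _ _ lim1 lim2.
  by move: (A _ v) (B _ v) (b v _) (ell' v) => x y z l /= xyz; rewrite addrAC xyz; ring.
have lim1 : (fun h => b (D h) q) @ 0^' --> b (lim (D @ 0^')) q.
  apply: (@bounded_additive_cvg _ _ _ _ _ D _ (b^~ q) (delta * `|q|)) => //.
    by move=> x y; rewrite (bilinear_forBl b_bil).
  by move=> x; rewrite mulrAC; exact: bilinear_for_bounded_norm.
have lim2 : (fun h => b (D h) q) @ 0^' --> 0.
  apply: (@norm_le_cvg _ R^o _ _ _ _ _ E) => //.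
  by apply: filterS near_E => h [-> _]; rewrite subrr normr0.
by rewrite w'E; exact: (@norm_cvg_unique _ R^o _ _ _ _ lim1 lim2).
Unshelve. all: by end_near. Qed.

End line_derivative.

(** * Mixed partial derivatives and Taylor coefficients *)

Lemma cvg_sum0 (R : realType) (T : Type) (F : set_system T) {FF : Filter F}
    (N : nat) (e : nat -> T -> R) :
  (forall j, (j < N)%N -> e j @ F --> (0 : R^o)) ->
  (fun x => \sum_(j < N) e j x) @ F --> (0 : R^o).
Proof.
elim: N => [|N IHN] eN.
  under eq_fun do rewrite big_ord0; exact: cvg_cst.
under eq_fun do rewrite big_ord_recr /=.
suff : (fun x => \sum_(j < N) e j x + e N x) @ F --> (0 + 0 : R^o) by rewrite addr0.
by apply: cvgD; [apply: IHN => j jN; apply: eN; exact: leqW|exact: eN].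
Qed.

Lemma derivable_cvg_derive1 (R : realType) (W : normedModType R) (f : R -> W) (a : R) :
  derivable f a 1 -> (fun h => h^-1 *: (f (h + a) - f a)) @ 0^' --> derive1 f a.
Proof.
rewrite /derivable.
have -> : (fun h : R => h^-1 *: ((f \o shift a) (h *: 1) - f a)) =
          (fun h => h^-1 *: (f (h + a) - f a)).
  by apply/funext => h /=; rewrite [h *: 1]mulr1.
by [].
Qed.

Section parametric_saddle.
Context {R : realType} {V Q : completeNormedModType R}.
Context (b : V -> Q -> R) (A : (nat -> R) -> V -> V -> R) (B : nat -> V -> V -> R).
Context (f : V -> R) (g : Q -> R) (u : (nat -> R) -> V) (p : (nat -> R) -> Q).
Context (K gamma delta : R) (C : nat -> R).
Hypothesis b_bil : bilinear_for *%R *%R b.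
Hypothesis A_bil : forall y, open_cube y -> bilinear_for *%R *%R (A y).
Hypothesis B_bil : forall j, bilinear_for *%R *%R (B j).
Hypothesis A_line : forall y (j : nat) (t : R) w v, open_cube y -> -1 < t < 1 ->
  A [eta y with j |-> t] w v = A y w v + (t - y j) * B j w v.
Hypothesis K_ge0 : 0 <= K.
Hypothesis C_ge0 : forall j, 0 <= C j.
Hypothesis A_bnd : forall y w v, open_cube y -> A y w v <= gamma * `|w| * `|v|.
Hypothesis B_bnd : forall j w v, B j w v <= C j * `|w| * `|v|.
Hypothesis b_bnd : forall v q, b v q <= delta * `|v| * `|q|.
Hypothesis stable : forall y, open_cube y -> saddle_stable b (A y) K.
Hypothesis solution : forall y, open_cube y -> saddle_solution (A y) b f g (u y) (p y).

Local Notation U := (mixed_partial^~ u).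
Local Notation P := (mixed_partial^~ p).

Definition derivable_on_cube (W : normedModType R) (psi : (nat -> R) -> W) : Prop :=
  forall (y : nat -> R) j, open_cube y -> derivable (coordinate_section psi j y) (y j) 1.

(** The Leibniz rule: [A] is affine in each [y j] with slope [B j], so differentiating the saddle
    point problem leaves only first-order couplings, with coefficients [nu j]. *)
Definition derivative_equation (nu : multi_index) : Prop :=
  forall N (y : nat -> R), supp_below N nu -> open_cube y ->
    (forall v, A y (U nu y) v + b v (P nu y) = (if nu == index_zero then f v else 0)
       - \sum_(j < N) (nu j)%:R * B j (U (dec_index j nu) y) v) /\
    (forall q, b (U nu y) q = if nu == index_zero then g q else 0).

Lemma open_cube_with (y : nat -> R) (j : nat) (t : R) : open_cube y -> -1 < t < 1 ->
  open_cube [eta y with j |-> t].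
Proof. by move=> yc t1 i /=; case: eqP. Qed.

Lemma with_id (y : nat -> R) j : ([eta y with j |-> y j] : nat -> R) = y.
Proof. by apply/funext => i /=; case: eqP => // ->. Qed.

(** The couplings to the predecessors are moved to the right-hand side [ell]; as they are
    differentiable, [saddle_line_derivative] applies along the coordinate [i]. *)
Lemma derivative_step (nu : multi_index) i N (y : nat -> R) :
  derivative_equation nu -> supp_below N nu ->
  (forall j, (0 < nu j)%N -> derivable_on_cube (U (dec_index j nu))) ->
  open_cube y ->
  [/\ derivable (coordinate_section (U nu) i y) (y i) 1,
      derivable (coordinate_section (P nu) i y) (y i) 1,
      (forall v, A y (partial i (U nu) y) v + B i (U nu y) v
         + b v (partial i (P nu) y) =
         - \sum_(j < N) (nu j)%:R * B j (partial i (U (dec_index j nu)) y) v) &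
      (forall q, b (partial i (U nu) y) q = 0)].
Proof.
move=> eq_nu nuN der_dec yc.
pose z j := coordinate_section (U (dec_index j nu)) i y.
pose ell (h : R) v := (if nu == index_zero then f v else 0)
  - \sum_(j < N) (nu j)%:R * B j (z j (h + y i)) v.
pose ell' v := - \sum_(j < N) (nu j)%:R * B j (derive1 (z j) (y i)) v.
pose quot j (h : R) := h^-1 *: (z j (h + y i) - z j (y i)).
pose e (h : R) := \sum_(j < N) (nu j)%:R * (C j * `|quot j h - derive1 (z j) (y i)|).
have near_cube : \forall h \near (0 : R), -1 < h + y i < 1.
  have shift_cvg : (fun h : R => h + y i) @ (0 : R) --> (0 + y i : R^o).
    by apply: cvgD; [exact: cvg_id|exact: cvg_cst].
  have /andP[y1 y2] := yc i; near=> h; apply/andP; split; near: h.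
    by apply: (cvgr_gt _ shift_cvg); rewrite add0r.
  by apply: (cvgr_lt _ shift_cvg); rewrite add0r.
have ci : coordinate_section (U nu) i y (y i) = U nu y.
  by rewrite /coordinate_section with_id.
have [||||||//|] := @saddle_line_derivative R V Q b (A y) (B i) K gamma (C i) delta
  b_bil (A_bil yc) (B_bil i) K_ge0 (C_ge0 i) _ (B_bnd i) b_bnd _ (y i)
  (coordinate_section (U nu) i y) (coordinate_section (P nu) i y) ell ell'
  (fun q => if nu == index_zero then g q else 0) e
  (\sum_(j < N) (nu j)%:R * (C j * `|derive1 (z j) (y i)|)).
- by move=> w v; exact: A_bnd.
- apply: filterS near_cube => h hc.
  have := stable (open_cube_with i yc hc).
  suff -> : A [eta y with i |-> h + y i] = (fun w v => A y w v + h * B i w v) by [].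
  by apply/funext => w; apply/funext => v; rewrite A_line// addrK.
- apply: filterS near_cube => h hc.
  have [H1 H2] := eq_nu N _ nuN (open_cube_with i yc hc).
  by split=> // v; have := H1 v; rewrite A_line// addrK.
- near=> h => v.
  have hn0 : h != 0 by near: h; exact: nbhs_dnbhs_neq.
  have -> : h^-1 * (ell h v - ell 0 v) - ell' v =
    - \sum_(j < N) (nu j)%:R * B j (quot j h - derive1 (z j) (y i)) v.
    rewrite /ell /ell' add0r.
    have -> : \sum_(j < N) (nu j)%:R * B j (quot j h - derive1 (z j) (y i)) v =
        h^-1 * (\sum_(j < N) (nu j)%:R * B j (z j (h + y i)) v
          - \sum_(j < N) (nu j)%:R * B j (z j (y i)) v)
        - \sum_(j < N) (nu j)%:R * B j (derive1 (z j) (y i)) v.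
      rewrite -sumrB mulr_sumr -sumrB; apply: eq_bigr => j _.
      rewrite (bilinear_forBl (B_bil j)) (bilinear_forZl (B_bil j)).
      by rewrite (bilinear_forBl (B_bil j)); ring.
    by ring.
  rewrite normrN; apply: le_trans (ler_norm_sum _ _ _) _.
  rewrite /e mulr_suml; apply: ler_sum => j _.
  rewrite normrM normr_nat -mulrA ler_wpM2l// .
  exact: bilinear_for_bounded_norm.
- apply: (@cvg_sum0 R _ _ _ N (fun j h =>
    (nu j)%:R * (C j * `|quot j h - derive1 (z j) (y i)|))) => j jN.
  (* If [nu j] is [0], then [dec_index j nu] is [nu] itself, whose differentiability is not known
     yet; the zero coefficient removes this term. *)
  have [->|nuj] := eqVneq (nu j) 0%N.
    by under eq_fun do rewrite mul0r; exact: cvg_cst.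
  have der_z : derivable (z j) (y i) 1 by apply: der_dec => //; rewrite lt0n.
  have quot_cvg := derivable_cvg_derive1 der_z.
  have d0 : (fun h => `|quot j h - derive1 (z j) (y i)|) @ 0^' --> (0 : R^o).
    apply/norm_cvg0P; rewrite -(subrr (derive1 (z j) (y i))).
    by apply: cvgB => //; exact: cvg_cst.
  suff : (fun h => (nu j)%:R * (C j * `|quot j h - derive1 (z j) (y i)|)) @ 0^' -->
      ((nu j)%:R * (C j * 0) : R^o) by rewrite !mulr0.
  by apply: cvgM; [exact: cvg_cst|apply: cvgM => //; exact: cvg_cst].
- by apply: sumr_ge0 => j _; rewrite mulr_ge0// mulr_ge0.
- move=> v; rewrite /ell' -sumrN mulr_suml; apply: ler_sum => j _.
  rewrite -mulrN -(bilinear_forNl (B_bil j)) -!mulrA ler_wpM2l//.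
  by rewrite mulrA -[ `|derive1 _ _|]normrN.
- by move=> D1 D2 E1 E2; split => // v; rewrite -[U nu y]ci -[RHS]/(ell' v) -E1.
Unshelve. all: by end_near. Qed.

(** Strong induction on the degree. The equation for [nu] is that of [mu], its predecessor in the
    smallest index [i], differentiated in [y i]; differentiability at [nu] then follows from
    [derivative_step] for [nu] itself. *)
Lemma derivative_equation_all nu :
  [/\ derivative_equation nu, derivable_on_cube (U nu) & derivable_on_cube (P nu)].
Proof.
have [n] := ubnP (index_degree nu); elim: n nu => // n IHn nu nun.
have IHdec j : (0 < nu j)%N -> [/\ derivative_equation (dec_index j nu),
    derivable_on_cube (U (dec_index j nu)) & derivable_on_cube (P (dec_index j nu))].
  by move=> nuj; apply: IHn; move: nun; rewrite (index_degree_dec nuj).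
suff eq_nu : derivative_equation nu.
  have [N nuN] := supp_belowP nu.
  have der_dec j : (0 < nu j)%N -> derivable_on_cube (U (dec_index j nu)).
    by move=> /IHdec[].
  by split=> // y i yc; have [] := derivative_step i eq_nu nuN der_dec yc.
have [nu0|nu0] := eqVneq nu index_zero; rewrite /derivative_equation => N y nuN yc.
  have [sol1 sol2] := solution yc; rewrite nu0 eqxx !mixed_partial0.
  split=> // v; rewrite sol1 big1 ?subr0// => j _.
  by rewrite index_zeroE mul0r.
rewrite (negPf nu0); have [i nui imin] := index_min nu0.
have [eq_mu _ _] := IHdec i nui; set mu := dec_index i nu in eq_mu.
have nuE : nu = inc_index i mu by rewrite /mu dec_indexK.
have mu_le j : (0 < mu j)%N -> (0 < nu j)%N.
  by rewrite nuE inc_indexE; case: eqP.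
have muN : supp_below N mu by exact: supp_below_dec.
have der_mu j : (0 < mu j)%N -> derivable_on_cube (U (dec_index j mu)).
  move=> muj; have /IHn[]// : (index_degree (dec_index j mu) < n)%N.
  by move: nun; rewrite (index_degree_dec nui) -/mu (index_degree_dec muj) ltnS => /ltnW.
have [_ _ E1 E2] := derivative_step i eq_mu muN der_mu yc.
have partial_mu (W : normedModType R) (psi : (nat -> R) -> W) :
    partial i (mixed_partial mu psi) = mixed_partial nu psi.
  by rewrite nuE mixed_partial_inc// => j /mu_le/imin.
rewrite !partial_mu in E1 E2; split=> [v|//]; rewrite sub0r.
have iN := supp_below_gt0 nuN nui.
(* As [nu i] is [mu i + 1], the term [B i (U mu y)] from the product rule supplies the missing unit
   in the coefficient of [j = i]. *)
have -> : \sum_(j < N) (nu j)%:R * B j (U (dec_index j nu) y) v =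
    \sum_(j < N) (mu j)%:R * B j (partial i (U (dec_index j mu)) y) v + B i (U mu y) v.
  rewrite [X in _ + X](_ : _ =
      \sum_(j < N) (if j == i :> nat then B i (U mu y) v else 0)).
    rewrite -big_split; apply: eq_bigr => j _ /=.
    have [muj|muj] := posnP (mu j).
      rewrite muj mul0r add0r {1}nuE inc_indexE; case: eqP => [ji|_].
        by rewrite ji in muj *; rewrite muj mul1r.
      by rewrite muj mul0r.
    have -> : partial i (U (dec_index j mu)) = U (dec_index j nu).
      rewrite mixed_partial_inc ?nuE ?dec_inc_indexC// => l.
      rewrite dec_indexE => H; apply/imin/mu_le; move: H.
      by case: eqP => // -> ; case: (mu j).
    rewrite {1}nuE inc_indexE; case: eqP => [ji|_]; last by rewrite addr0.
    by rewrite ji -/mu -natr1 mulrDl mul1r.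
  rewrite (bigD1 (Ordinal iN))//= eqxx big1 ?addr0// => j.
  by rewrite -val_eqE /= => /negPf ->.
by rewrite opprD -E1; ring.
Qed.

End parametric_saddle.

Definition index_weight {R : realType} (rho : nat -> R) (nu : multi_index) : R :=
  \prod_(j <- finsupp nu) rho j ^+ nu j.

Lemma index_weight0 (R : realType) (rho : nat -> R) : index_weight rho index_zero = 1.
Proof. by rewrite /index_weight finsupp0 big_nil. Qed.

Lemma index_weight_dec (R : realType) (rho : nat -> R) (nu : multi_index) j :
  (0 < nu j)%N -> index_weight rho nu = rho j * index_weight rho (dec_index j nu).
Proof.
move=> nuj; rewrite /index_weight.
have [//|Z -> ->] := big_finsupp_dec *%R (F := fun i n => rho i ^+ n) _ nuj.
by rewrite mulrA -exprS prednK.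
Qed.

Lemma index_weight_ge0 (R : realType) (rho : nat -> R) nu :
  (forall j, 0 <= rho j) -> 0 <= index_weight rho nu.
Proof. by move=> rho0; apply: prodr_ge0 => j _; rewrite exprn_ge0. Qed.

Section taylor_recursion.
Context {R : realType} {V Q : completeNormedModType R}.
Context (b : V -> Q -> R) (A : (nat -> R) -> V -> V -> R) (B : nat -> V -> V -> R).
Context (f : V -> R) (g : Q -> R) (u : (nat -> R) -> V) (p : (nat -> R) -> Q).
Hypothesis b_bil : bilinear_for *%R *%R b.
Hypothesis A_bil : bilinear_for *%R *%R (A (fun=> 0)).
Hypothesis B_bil : forall j, bilinear_for *%R *%R (B j).

(** Division by [nu!] absorbs the Leibniz coefficients, since [nu_j / nu!] is [1 / (nu - e_j)!]. *)
Lemma taylor_coef_equation nu N : derivative_equation b A B f g u p nu ->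
  supp_below N nu ->
  (forall v, A (fun=> 0) (taylor_coef u nu) v + b v (taylor_coef p nu) =
     (if nu == index_zero then f v else 0)
     - \sum_(j < N | (0 < nu j)%N) B j (taylor_coef u (dec_index j nu)) v) /\
  (forall q, b (taylor_coef u nu) q = if nu == index_zero then g q else 0).
Proof.
move=> eq_nu nuN.
have c0 : open_cube (fun=> 0 : R) by move=> j; rewrite oppr_lt0 ltr01.
have [E1 E2] := eq_nu N _ nuN c0.
have fact_neq0 mu : (multi_fact mu)%:R != 0 :> R.
  by rewrite pnatr_eq0 -lt0n multi_fact_gt0.
have fact1 : nu = index_zero -> (multi_fact nu)%:R = 1 :> R.
  by move=> ->; rewrite /multi_fact finsupp0 big_nil.
split=> [v|q]; last first.
  rewrite /taylor_coef (bilinear_forZl b_bil) E2.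
  by case: eqP => [/fact1->|_]; rewrite ?invr1 ?mul1r ?mulr0.
rewrite {1 2}/taylor_coef (bilinear_forZl A_bil) (bilinear_forZr b_bil).
rewrite -mulrDr E1 mulrBr; congr (_ - _).
  by case: eqP => [/fact1->|_]; rewrite ?invr1 ?mul1r ?mulr0.
rewrite mulr_sumr [RHS]big_mkcond; apply: eq_bigr => j _ /=.
case: ifPn => [nuj|]; last by rewrite -eqn0Ngt => /eqP ->; rewrite mul0r mulr0.
rewrite /taylor_coef (bilinear_forZl (B_bil j)) (multi_fact_dec nuj) natrM.
have nuj0 : (nu j)%:R != 0 :> R by rewrite pnatr_eq0 -lt0n.
by field; rewrite nuj0 fact_neq0.
Qed.

End taylor_recursion.

(** * Energy estimate over down-closed sets of multi-indices *)

Section energy_estimate.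
Context {R : realType} {V : normedModType R}.
Context (t : multi_index -> V) (A : V -> V -> R) (B : nat -> V -> V -> R).
(** In the application [X j w] is the diagonal value at [w] of [a1] for the absolute value of the
    truncated [k j], and [M] bounds the weighted energy at index zero. *)
Context (X : nat -> V -> R) (rho : nat -> R) (alpha M : R).
Hypothesis B_bil : forall j, bilinear_for *%R *%R (B j).
Hypothesis t_rec : forall nu N, nu != index_zero -> supp_below N nu ->
  A (t nu) (t nu) = - \sum_(j < N | (0 < nu j)%N) B j (t (dec_index j nu)) (t nu).
Hypothesis B_young : forall j w v, - B j w v <= 2^-1 * (X j w + X j v).
Hypothesis X_ge0 : forall j w, 0 <= X j w.
Hypothesis X_scale : forall j c w, X j (c *: w) = c ^+ 2 * X j w.
Hypothesis rho_ge0 : forall j, 0 <= rho j.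
Hypothesis alpha_ge0 : 0 <= alpha.
Hypothesis A_coercive : forall nu N, nu != index_zero ->
  alpha * `|t nu| ^+ 2 + \sum_(j < N) rho j * X j (t nu) <= A (t nu) (t nu).
Hypothesis t0_le : forall N, \sum_(j < N) rho j * X j (t index_zero) <= M.

Local Notation W := (index_weight rho).

(* Summing the energy balances over a down-closed set of indices, Young's
   inequality splits each coupling term evenly between an index and its
   predecessor, so everything but the root term cancels. *)
Lemma weighted_energy_estimate nu : nu != index_zero ->
  alpha * (W nu * `|t nu|) ^+ 2 <= M / 2.
Proof.
move=> nu0.
have [L Ldown XL] := down_closure [fset nu; index_zero]%fset.
have nuL : nu \in L by apply: XL; rewrite in_fset2 eqxx.
have zL : index_zero \in L by apply: XL; rewrite in_fset2 eqxx orbT.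
have [N LN] := fset_supp_belowP L.
pose x j mu := W mu ^+ 2 * X j (t mu).
have x_ge0 j mu : 0 <= x j mu by rewrite mulr_ge0 ?sqr_ge0.
have balance mu : mu \in L -> mu != index_zero ->
    alpha * (W mu * `|t mu|) ^+ 2 + 2^-1 * \sum_(j < N) rho j * x j mu <=
    2^-1 * \sum_(j < N | (0 < mu j)%N) rho j * x j (dec_index j mu).
  move=> muL mu0; have muN := LN mu muL.
  have coupling : W mu ^+ 2 * A (t mu) (t mu) <=
      2^-1 * \sum_(j < N | (0 < mu j)%N) rho j * x j (dec_index j mu)
      + 2^-1 * \sum_(j < N) rho j * x j mu.
    rewrite (t_rec mu0 muN) -sumrN mulr_sumr.
    apply: (@le_trans _ _ (\sum_(j < N | (0 < mu j)%N)
        (2^-1 * (rho j * x j (dec_index j mu)) + 2^-1 * (rho j * x j mu)))).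
      apply: ler_sum => j muj.
      (* One of the two factors [W mu] is split into [rho j] and the weight of the predecessor, so
         that Young's inequality applies to the weighted coefficients and puts the same [rho j] on
         both. *)
      have -> : W mu ^+ 2 * - B j (t (dec_index j mu)) (t mu) =
          rho j * - B j (W (dec_index j mu) *: t (dec_index j mu)) (W mu *: t mu).
        rewrite (bilinear_forZl (B_bil j)) (bilinear_forZr (B_bil j)).
        by rewrite expr2 {1}(index_weight_dec rho muj); ring.
      apply: le_trans (ler_wpM2l (rho_ge0 j) (B_young _ _ _)) _.
      by rewrite !X_scale -/(x j _) -/(x j _) mulrCA -mulrDr -mulrDr.
    rewrite big_split /= -!mulr_sumr lerD2l ler_wpM2l ?invr_ge0//.
    rewrite big_mkcond /=; apply: ler_sum => j _; case: ifP => // _.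
    by rewrite mulr_ge0.
  have := ler_wpM2l (sqr_ge0 (W mu)) (A_coercive N mu0).
  have -> : W mu ^+ 2 * (alpha * `|t mu| ^+ 2 + \sum_(j < N) rho j * X j (t mu)) =
      alpha * (W mu * `|t mu|) ^+ 2 + \sum_(j < N) rho j * x j mu.
    rewrite mulrDr mulr_sumr exprMn mulrCA; congr (_ + _).
    by apply: eq_bigr => j _; rewrite mulrCA.
  by move: coupling; lra.
have total : \sum_(mu <- L | mu != index_zero)
    (alpha * (W mu * `|t mu|) ^+ 2 + 2^-1 * \sum_(j < N) rho j * x j mu) <=
    2^-1 * (\sum_(j < N) rho j * x j index_zero
      + \sum_(mu <- L | mu != index_zero) \sum_(j < N) rho j * x j mu).
  apply: (@le_trans _ _ (\sum_(mu <- L | mu != index_zero)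
      (2^-1 * \sum_(j < N | (0 < mu j)%N) rho j * x j (dec_index j mu)))).
    rewrite big_seq_cond [leRHS]big_seq_cond.
    by apply: ler_sum => mu /andP[]; exact: balance.
  (* For fixed [j] the predecessors are distinct members of [L], so their sum is at most the sum
     over [L], which exceeds the one on the left only by the term of index zero. *)
  rewrite -mulr_sumr ler_wpM2l ?invr_ge0// (exchange_big_dep xpredT)//=.
  rewrite [X in _ + X]exchange_big -big_split /=; apply: ler_sum => j _.
  apply: (@le_trans _ _ (\sum_(mu <- L) rho j * x j mu)).
    rewrite -!mulr_sumr ler_wpM2l//.
    rewrite (eq_bigl (fun mu : multi_index => xpredT mu && (0 < mu j)%N)); last first.
      by move=> mu /=; apply: andb_idl; exact: index_gt0_neq0.
    exact: (ler_sum_dec (F := x j)).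
  by rewrite (bigD1_seq index_zero) ?fset_uniq.
have x0 : \sum_(j < N) rho j * x j index_zero <= M.
  by under eq_bigr => j _ do rewrite /x index_weight0 expr1n mul1r.
have nu_le : alpha * (W nu * `|t nu|) ^+ 2 <=
    \sum_(mu <- L | mu != index_zero) alpha * (W mu * `|t mu|) ^+ 2.
  rewrite [leRHS](bigID (pred1 nu)) /= -[leLHS]addr0 lerD//; last first.
    by apply: sumr_ge0 => mu _; rewrite mulr_ge0 ?sqr_ge0.
  rewrite (eq_bigl (pred1 nu)); last first.
    by move=> mu /=; apply: andb_idl => /eqP ->.
  by rewrite -big_filter filter_pred1_uniq ?fset_uniq// big_seq1.
rewrite -mulr_sumr in nu_le; move: total.
by rewrite big_split /= -2!mulr_sumr mulrDr; move: nu_le x0; lra.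
Qed.

End energy_estimate.

(** * Summability of multinomial weights *)

Definition tail_degree (J : nat) (nu : multi_index) : nat :=
  (\sum_(j <- finsupp nu) if (J <= j)%N then nu j else 0)%N.

Definition tail_fact (J : nat) (nu : multi_index) : nat :=
  (\prod_(j <- finsupp nu) if (J <= j)%N then (nu j)`! else 1)%N.

Definition tail_multinomial (R : realType) (J : nat) (nu : multi_index) : R :=
  (tail_degree J nu)`!%:R / (tail_fact J nu)%:R.

Lemma tail_degree_dec J (nu : multi_index) j : (0 < nu j)%N ->
  tail_degree J nu = ((J <= j)%N + tail_degree J (dec_index j nu))%N.
Proof.
move=> nuj; rewrite /tail_degree.
have [i|Z -> ->] := big_finsupp_dec addn
  (F := fun i n => if (J <= i)%N then n else 0%N) _ nuj; first by case: ifP.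
by case: ifP => _ //; rewrite addnA add1n prednK.
Qed.

Lemma tail_fact_dec J (nu : multi_index) j : (0 < nu j)%N ->
  tail_fact J nu =
  ((if (J <= j)%N then nu j else 1) * tail_fact J (dec_index j nu))%N.
Proof.
move=> nuj; rewrite /tail_fact.
have [i|Z -> ->] := big_finsupp_dec muln
  (F := fun i n => if (J <= i)%N then n`! else 1%N) _ nuj; first by case: ifP.
by case: ifP => _; rewrite ?mul1n// mulnA; case: (nu j) nuj.
Qed.

Lemma tail_fact_gt0 J nu : (0 < tail_fact J nu)%N.
Proof. by apply: prodn_gt0 => j; case: ifP => // _; apply: fact_gt0. Qed.

Lemma leq_mul_fact m n : (m`! * n`! <= (m + n)`!)%N.
Proof.
by rewrite -(bin_fact (leq_addr n m)) addKn leq_pmull// bin_gt0 leq_addr.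
Qed.

(** By [leq_mul_fact], factor by factor. This lower bound later allows the power [s] of a
    multinomial coefficient to be replaced by the coefficient. *)
Lemma tail_multinomial_ge1 (R : realType) J nu : 1 <= tail_multinomial R J nu.
Proof.
rewrite ler_pdivlMr ?ltr0n ?tail_fact_gt0// mul1r ler_nat /tail_fact /tail_degree.
apply: (big_ind2 (fun m n => (m <= n`!)%N)) => [//|m1 n1 m2 n2 le1 le2|j _].
  exact: leq_trans (leq_mul le1 le2) (leq_mul_fact _ _).
by case: ifP.
Qed.

Lemma tail_multinomial_head (R : realType) J (nu : multi_index) j :
  (0 < nu j)%N -> (j < J)%N ->
  tail_multinomial R J (dec_index j nu) = tail_multinomial R J nu.
Proof.
move=> nuj; rewrite ltnNge => /negPf jJ; rewrite /tail_multinomial.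
by rewrite (tail_degree_dec J nuj) (tail_fact_dec J nuj) jJ mul1n add0n.
Qed.

Lemma tail_multinomial_tail (R : realType) J (nu : multi_index) j :
  (0 < nu j)%N -> (J <= j)%N ->
  (tail_degree J nu)%:R * tail_multinomial R J (dec_index j nu) =
  (nu j)%:R * tail_multinomial R J nu.
Proof.
move=> nuj jJ; rewrite /tail_multinomial.
rewrite (tail_degree_dec J nuj) (tail_fact_dec J nuj) jJ add1n factS !natrM.
have ? : (nu j)%:R != 0 :> R by rewrite pnatr_eq0 -lt0n.
have ? : (tail_fact J (dec_index j nu))%:R != 0 :> R.
  by rewrite pnatr_eq0 -lt0n tail_fact_gt0.
by field; apply/andP.
Qed.

Section multinomial_sum.
Context {R : realType} (J : nat) (q sigma : R) (D : nat -> R).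
Hypothesis D_ge0 : forall j, 0 <= D j.
Hypothesis q_lt1 : q < 1.
Hypothesis D_head : forall j, (j < J)%N -> D j = q.
Hypothesis sigma_lt1 : sigma < 1.
Hypothesis D_tail : forall N, \sum_(j < N | (J <= j)%N) D j <= sigma.

Definition multinomial_weight (nu : multi_index) : R :=
  tail_multinomial R J nu * index_weight D nu.

Local Notation Phi := multinomial_weight.

Lemma multinomial_weight_ge0 nu : 0 <= Phi nu.
Proof.
by rewrite mulr_ge0 ?index_weight_ge0// (le_trans ler01 (tail_multinomial_ge1 _ _ _)).
Qed.

Lemma multinomial_weight_head (nu : multi_index) j : (0 < nu j)%N -> (j < J)%N ->
  Phi nu = q * Phi (dec_index j nu).
Proof.
move=> nuj jJ; rewrite /multinomial_weight (tail_multinomial_head _ nuj jJ).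
by rewrite (index_weight_dec D nuj) (D_head jJ); ring.
Qed.

(** Pascal's rule for multinomial coefficients, valid once the head coordinates vanish: multiplying
    by the degree, which is the sum of the [nu j], reduces it term by term to
    [tail_multinomial_tail]. *)
Lemma multinomial_weight_tail (nu : multi_index) N : nu != index_zero ->
  supp_below N nu -> (forall j, (j < J)%N -> nu j = 0%N) ->
  Phi nu = \sum_(j < N | (0 < nu j)%N) D j * Phi (dec_index j nu).
Proof.
move=> nu0 nuN head0.
have degE : tail_degree J nu = (\sum_(j < N) nu j)%N.
  rewrite /tail_degree (big_finsupp addn nuN) => [|i ->]; last by case: ifP.
  by apply: eq_bigr => j _; case: leqP => // /head0.
have deg_gt0 : (0 < tail_degree J nu)%N.
  have [j nuj] := index_neq0 nu0; rewrite (tail_degree_dec J nuj).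
  by case: (leqP J j) => [_|/head0 nuj0]; rewrite ?add1n//; rewrite nuj0 in nuj.
have deg_neq0 : (tail_degree J nu)%:R != 0 :> R by rewrite pnatr_eq0 -lt0n.
apply: (mulfI deg_neq0); rewrite {1}degE natr_sum mulr_suml mulr_sumr.
rewrite [RHS]big_mkcond; apply: eq_bigr => j _.
case: ifPn => [nuj|]; last by rewrite -eqn0Ngt => /eqP ->; rewrite mul0r.
have Jj : (J <= j)%N by rewrite leqNgt; apply: contraTN nuj => /head0 ->.
rewrite /multinomial_weight (index_weight_dec D nuj) [LHS]mulrA.
rewrite -(tail_multinomial_tail R nuj Jj); ring.
Qed.

(** [S k] sums over the indices whose first [k] entries vanish. Pascal's rule gives
    [S J <= 1 + sigma * S J], which can be solved as [sigma < 1]; freeing the head coordinates one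
    at a time costs a factor [(1 - q)^-1] each. *)
Lemma multinomial_sum_le (L : {fset multi_index}) : down_closed L ->
  index_zero \in L ->
  \sum_(nu <- L) Phi nu <= ((1 - sigma) * (1 - q) ^+ J)^-1.
Proof.
move=> Ldown zL; have [N LN] := fset_supp_belowP L.
pose zero_below k (nu : multi_index) := all (fun j => nu j == 0%N) (iota 0 k).
have zero_belowP k (nu : multi_index) :
    reflect (forall j, (j < k)%N -> nu j = 0%N) (zero_below k nu).
  apply: (iffP allP) => nu0 j; last by rewrite mem_iota => /nu0/eqP.
  by move=> jk; apply/eqP/nu0; rewrite mem_iota.
have zero_below_dec k j nu : zero_below k nu -> (0 < nu j)%N ->
    zero_below k (dec_index j nu).
  move=> /zero_belowP nu0 _; apply/zero_belowP => i /nu0 nui.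
  by rewrite dec_indexE; case: eqP => // <-; rewrite nui.
pose S k := \sum_(nu <- L | zero_below k nu) Phi nu.
have S_ge0 k : 0 <= S k by apply: sumr_ge0 => nu _; exact: multinomial_weight_ge0.
have SJ : (1 - sigma) * S J <= 1.
  suff : S J <= 1 + sigma * S J by lra.
  have z0 : zero_below J index_zero by apply/zero_belowP => j _; rewrite index_zeroE.
  have SE : S J = Phi index_zero +
      \sum_(nu <- L | zero_below J nu && (nu != index_zero)) Phi nu.
    rewrite /S (bigID (pred1 index_zero)) /=; congr (_ + _).
    rewrite (eq_bigl (pred1 index_zero)); last first.
      by move=> nu /=; apply: andb_idl => /eqP ->.
    by rewrite -big_filter filter_pred1_uniq ?fset_uniq// big_seq1.
  rewrite {1}SE; apply: lerD.
    rewrite /multinomial_weight index_weight0 /tail_multinomial /tail_degree /tail_fact.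
    by rewrite finsupp0 !big_nil divr1 mulr1.
  apply: (@le_trans _ _ (\sum_(nu <- L | zero_below J nu && (nu != index_zero))
      \sum_(j < N | (0 < nu j)%N) D j * Phi (dec_index j nu))).
    rewrite big_seq_cond [leRHS]big_seq_cond; apply: ler_sum => nu.
    move=> /andP[nuL /andP[/zero_belowP head0 nu0]].
    by rewrite -multinomial_weight_tail//; exact: LN.
  rewrite (exchange_big_dep xpredT)//=.
  apply: (@le_trans _ _ (\sum_(j < N | (J <= j)%N) D j * S J)); last first.
    by rewrite -mulr_suml ler_wpM2r.
  rewrite [leRHS]big_mkcond /=; apply: ler_sum => j _.
  case: leqP => [Jj|jJ]; last first.
    rewrite big1// => nu /andP[/andP[/zero_belowP head0 _]].
    by rewrite head0.
  rewrite -mulr_sumr ler_wpM2l//.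
  rewrite (eq_bigl (fun nu : multi_index => zero_below J nu && (0 < nu j)%N)); last first.
    move=> nu /=; rewrite -andbA; congr (_ && _); apply: andb_idl.
    exact: index_gt0_neq0.
  apply: ler_sum_dec => // nu; first exact: multinomial_weight_ge0.
  exact: zero_below_dec.
have Sk k : (k < J)%N -> (1 - q) * S k <= S k.+1.
  move=> kJ; suff : S k <= S k.+1 + q * S k by lra.
  rewrite {1}/S (bigID (fun nu : multi_index => nu k == 0%N)) /=; apply: lerD.
    rewrite le_eqVlt; apply/orP; left; apply/eqP; apply: eq_bigl => nu.
    by rewrite /zero_below -(addn1 k) iotaD all_cat /= add0n andbT.
  rewrite (eq_bigl (fun nu : multi_index => zero_below k nu && (0 < nu k)%N)); last first.
    by move=> nu /=; rewrite lt0n.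
  rewrite (eq_bigr (fun nu => q * Phi (dec_index k nu))); last first.
    by move=> nu /andP[_ nuk]; exact: multinomial_weight_head.
  (* The sign of [q] comes from [q = D k], available because [k < J]. *)
  rewrite -mulr_sumr ler_wpM2l -?(D_head kJ)//.
  apply: ler_sum_dec => // nu; first exact: multinomial_weight_ge0.
  exact: zero_below_dec.
have q1 : 0 < 1 - q by rewrite subr_gt0.
have S0 k : (k <= J)%N -> (1 - q) ^+ k * S 0 <= S k.
  elim: k => [|k IHk] kJ; first by rewrite expr0 mul1r.
  apply: le_trans (Sk k kJ); rewrite exprS -mulrA ler_wpM2l ?(ltW q1)//.
  exact/IHk/ltnW.
have sigma1 : 0 < 1 - sigma by rewrite subr_gt0.
rewrite -[leRHS]mul1r ler_pdivlMr ?mulr_gt0 ?exprn_gt0// mulrC.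
apply: le_trans SJ; rewrite -mulrA ler_wpM2l ?(ltW sigma1)//.
apply: le_trans (S0 J (leqnn J)); rewrite ler_wpM2l ?exprn_ge0 ?(ltW q1)//.
Qed.

End multinomial_sum.

(** [n^n / n!] is a single term of the exponential series at [n], whose sum is [e^n]. *)
Lemma expn_le_expR_fact (R : realType) (n : nat) :
  n%:R ^+ n <= expR 1 ^+ n * n`!%:R :> R.
Proof.
case: n => [|n]; first by rewrite !expr0 mul1r.
rewrite -ler_pdivrMr ?ltr0n ?fact_gt0// -expRM_natl mulr1.
by apply: le_trans (expR_ge1Dxn n _); rewrite ?ler0n// lerDr.
Qed.

Lemma fact_le_expn n : (n`! <= n ^ n)%N.
Proof.
elim: n => // n IHn; rewrite factS expnS leq_mul2l (leq_trans IHn) ?orbT//.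
by case: n {IHn} => // n; rewrite leq_exp2r.
Qed.

Lemma powR_index_weight (R : realType) (beta : nat -> R) (nu : multi_index) a :
  (forall j, 0 < beta j) ->
  index_weight beta nu `^ a = index_weight (fun j => beta j `^ a) nu.
Proof.
move=> beta0; rewrite /index_weight; elim: (finsupp nu : seq nat) => [|j s IHs].
  by rewrite !big_nil powR1.
have prod_ge0 : 0 <= \prod_(i <- s) beta i ^+ nu i.
  by apply: prodr_ge0 => i _; rewrite exprn_ge0 ?ltW.
rewrite !big_cons powRM ?exprn_ge0 ?(ltW (beta0 j))// IHs; congr (_ * _).
rewrite -(powR_mulrn (nu j) (ltW (beta0 j))).
by rewrite -(powR_mulrn (nu j) (powR_ge0 (beta j) a)) powRAC.
Qed.

(** * Weights adapted to a multi-index *)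

Section adapted_weight.
Context {R : realType} (J : nat) (beta : nat -> R).
Hypothesis beta_gt0 : forall j, 0 < beta j.

(* Distributes the budget of the coordinates [j >= J] proportionally to [nu j];
   for [tail_degree J nu = 0] all the factors beyond [J] are [0] but occur with
   exponent [0]. *)
Definition adapted_weight (nu : multi_index) (j : nat) : R :=
  if (j < J)%N then beta j
  else expR 1 * beta j * ((nu j)%:R / (tail_degree J nu)%:R).

Lemma adapted_weight_ge0 nu j : 0 <= adapted_weight nu j.
Proof.
have beta_ge0 := ltW (beta_gt0 j).
by rewrite /adapted_weight; case: ifP => // _; rewrite !mulr_ge0 ?expR_ge0 ?invr_ge0.
Qed.

(** The adapted weight equals [beta^nu * e^n / n^n] times the product of [nu_j^nu_j] over [j >= J].
    As [nu_j^nu_j >= nu_j!] and [n^n <= e^n * n!], the multinomial coefficient makes up for the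
    loss; hence the factor [expR 1] in [adapted_weight]. *)
Lemma index_weight_adapted (nu : multi_index) :
  index_weight beta nu <=
  tail_multinomial R J nu * index_weight (adapted_weight nu) nu.
Proof.
set n := tail_degree J nu.
have -> : index_weight (adapted_weight nu) nu = index_weight beta nu *
    ((expR 1 / n%:R) ^+ n *
     \prod_(j <- finsupp nu) if (J <= j)%N then (nu j)%:R ^+ nu j else 1).
  rewrite /n /tail_degree expr_sum -!big_split /=; apply: eq_bigr => j _.
  rewrite /adapted_weight ltnNge; case: leqP => _ /=; last by rewrite expr0 !mulr1.
  by rewrite -exprMn -exprMn -/n; congr (_ ^+ _); ring.
have pow_gt0 : 0 <= index_weight beta nu.
  by apply: index_weight_ge0 => j; exact: ltW.
rewrite mulrCA -[leLHS]mulr1 ler_wpM2l//.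
set P := \prod_(j <- _) _.
have T_gt0 : 0 < (tail_fact J nu)%:R :> R by rewrite ltr0n tail_fact_gt0.
have TP : (tail_fact J nu)%:R <= P.
  have -> : P = (\prod_(j <- finsupp nu) if (J <= j)%N then nu j ^ nu j else 1)%N%:R.
    by rewrite natr_prod; apply: eq_bigr => j _; case: ifP; rewrite ?natrX.
  rewrite ler_nat; apply: (big_ind2 leq) => // [m1 n1 m2 n2|j _]; first exact: leq_mul.
  by case: ifP => // _; exact: fact_le_expn.
have en : 1 <= n`!%:R * (expR 1 / n%:R) ^+ n :> R.
  have [->|n0] := posnP n; first by rewrite expr0 mulr1.
  rewrite expr_div_n mulrA ler_pdivlMr ?exprn_gt0 ?ltr0n// mul1r mulrC.
  exact: expn_le_expR_fact.
rewrite /tail_multinomial -/n.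
rewrite mulrACA [_^-1 * P]mulrC.
by rewrite -[leLHS]mulr1 ler_pM// ler_pdivlMr// mul1r.
Qed.

(** The multinomial coefficient is at least [1] and [s < 1], so its power [s] is at most the
    coefficient itself; only the weights [beta] keep the exponent. *)
Lemma powR_le_multinomial_weight (nu : multi_index) (s x M : R) : 0 < s < 1 ->
  0 <= x -> 0 <= M -> index_weight (adapted_weight nu) nu * x <= M ->
  x `^ s <= M `^ s * multinomial_weight J (fun j => beta j `^ (- s)) nu.
Proof.
move=> /andP[s0 s1] x0 M0 xM.
have Wb_gt0 : 0 < index_weight beta nu.
  by apply: prodr_gt0 => j _; rewrite exprn_gt0.
have m1 := tail_multinomial_ge1 R J nu; have m0 := le_trans ler01 m1.
have xWb : x * index_weight beta nu <= tail_multinomial R J nu * M.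
  apply: (@le_trans _ _ (x * (tail_multinomial R J nu *
      index_weight (adapted_weight nu) nu))).
    by rewrite ler_wpM2l ?index_weight_adapted.
  by rewrite mulrCA ler_wpM2l// mulrC.
rewrite /multinomial_weight -powR_index_weight// powRN mulrA.
rewrite ler_pdivlMr ?powR_gt0// -powRM ?(ltW Wb_gt0)//.
apply: (@le_trans _ _ ((tail_multinomial R J nu * M) `^ s)).
  by rewrite ge0_ler_powR ?nnegrE ?mulr_ge0 ?(ltW Wb_gt0)// ltW.
rewrite powRM// mulrC ler_wpM2l ?powR_ge0//.
exact: ler1_powR m1 (ltW s1).
Qed.

End adapted_weight.

Lemma esum_fin_le (R : realType) (T : choiceType) (F : T -> R) (C : R) :
  (forall X : {fset T}, \sum_(x <- X) F x <= C) ->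
  (\esum_(x in [set: T]) (F x)%:E < +oo)%E.
Proof.
move=> FC; apply: (@le_lt_trans _ _ C%:E); last exact: ltry.
apply: ub_ereal_sup => _ [X [Xfin _] <-].
by rewrite fsbig_finite//= sumEFin lee_fin.
Qed.

(** [J] is chosen so that the partial sum up to [J] is within [eps] of the supremum of all partial
    sums. *)
Lemma series_tail_le (R : realType) (a : nat -> R) (S eps : R) :
  (forall j, 0 <= a j) -> (forall N, \sum_(j < N) a j <= S) -> 0 < eps ->
  exists J, forall N, \sum_(j < N | (J <= j)%N) a j <= eps.
Proof.
move=> a0 aS eps0; pose E := range (fun N => \sum_(j < N) a j).
have supE : has_sup E.
  by split; [exists (\sum_(j < 0) a j), 0%N|exists S => _ [N _ <-]].
have [_ [J _ <-] J_lt] := sup_adherent eps0 supE.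
exists J => N; have [NJ|JN] := leqP N J.
  rewrite big_pred0 ?ltW// => j; apply/negbTE; rewrite -ltnNge.
  exact: leq_trans (ltn_ord j) NJ.
have sumN : \sum_(j < N) a j <= sup E by apply: ub_le_sup; [case: supE|exists N].
suff : \sum_(j < N) a j = \sum_(j < J) a j + \sum_(j < N | (J <= j)%N) a j.
  by move: J_lt sumN; lra.
rewrite (bigID (fun j : 'I_N => (j < J)%N)) /= -(big_ord_widen _ a (ltnW JN)).
by congr (_ + _); apply: eq_bigl => j; rewrite -leqNgt.
Qed.

(** Every finite set of indices lies in a down-closed one containing zero, where
    [multinomial_sum_le] gives a bound independent of the set. *)
Lemma multinomial_summable (R : realType) (J : nat) (q sigma : R) (D : nat -> R)
    (F : multi_index -> R) (C : R) :
  (forall j, 0 <= D j) -> q < 1 -> (forall j, (j < J)%N -> D j = q) ->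
  sigma < 1 -> (forall N, \sum_(j < N | (J <= j)%N) D j <= sigma) ->
  0 <= C -> (forall nu, 0 <= F nu <= C * multinomial_weight J D nu) ->
  (\esum_(nu in [set: multi_index]) (F nu)%:E < +oo)%E.
Proof.
move=> D0 q1 Dq sigma1 Dsigma C0 FC.
apply: (@esum_fin_le _ _ _ (C * ((1 - sigma) * (1 - q) ^+ J)^-1)) => X.
have [L Ldown XL] := down_closure (index_zero |` X)%fset.
apply: (@le_trans _ _ (\sum_(nu <- L) F nu)).
  apply: ler_sum_uniq_sub; rewrite ?fset_uniq// => nu.
    by move=> nuX; apply: XL; rewrite !inE nuX orbT.
  by have /andP[] := FC nu.
apply: (@le_trans _ _ (\sum_(nu <- L) C * multinomial_weight J D nu)).
  by apply: ler_sum => nu _; have /andP[] := FC nu.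
rewrite -mulr_sumr ler_wpM2l// multinomial_sum_le//.
by apply: XL; rewrite !inE eqxx.
Qed.

Lemma tail_sum_le J (nu : multi_index) N :
  (\sum_(j < N | (J <= j)%N) nu j <= tail_degree J nu)%N.
Proof.
have [M nuM] := supp_belowP nu.
have nuNM : supp_below (N + M) nu by apply: supp_below_le nuM; rewrite leq_addl.
rewrite /tail_degree (big_finsupp addn nuNM) => [|i ->]; last by case: ifP.
rewrite -(big_mkord (fun j => J <= j)%N).
rewrite -(big_mkord xpredT (fun j => if (J <= j)%N then nu j else 0%N)).
by rewrite [in leqRHS](@big_cat_nat _ _ _ N) ?leq_addr//= -big_mkcond leq_addr.
Qed.

(** Beyond [J] each summand is at most [c * nu_j / n], and these fractions sum to at most [1]. It
    serves both for [m] the bounds [B] and for [m] the truncated coefficients at a point. *)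
Lemma adapted_weight_sum_le (R : realType) J (beta m : nat -> R) (c : R)
    (nu : multi_index) N :
  (forall j, 0 <= beta j) -> 0 <= c ->
  (forall j, (J <= j)%N -> expR 1 * beta j * m j <= c) ->
  \sum_(j < N) adapted_weight J beta nu j * m j <=
  \sum_(j < N | (j < J)%N) beta j * m j + c.
Proof.
move=> beta0 c0 mc; rewrite (bigID (fun j : 'I_N => (j < J)%N)) /=; apply: lerD.
  by apply: ler_sum => j jJ; rewrite /adapted_weight jJ.
(* For degree zero the convention [0^-1 = 0] makes all weights beyond [J] vanish. *)
have [n0|n_gt0] := posnP (tail_degree J nu).
  by rewrite big1// => j /negPf jJ; rewrite /adapted_weight jJ n0 invr0 !mulr0 mul0r.
have n_gt0' : 0 < (tail_degree J nu)%:R :> R by rewrite ltr0n.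
apply: (@le_trans _ _ (\sum_(j < N | (J <= j)%N) c * ((nu j)%:R / (tail_degree J nu)%:R))).
  under eq_bigl do rewrite -leqNgt.
  apply: ler_sum => j jJ; rewrite /adapted_weight ltnNge jJ /= mulrAC.
  by rewrite ler_wpM2r ?divr_ge0// mc.
rewrite -mulr_sumr -mulr_suml ler_piMr// ler_pdivrMr// mul1r -natr_sum ler_nat.
exact: tail_sum_le.
Qed.

Lemma sum_half_le1 (R : realType) N : \sum_(j < N) 2^-1 ^+ j.+1 <= 1 :> R.
Proof.
suff -> : \sum_(j < N) 2^-1 ^+ j.+1 = 1 - 2^-1 ^+ N :> R.
  by rewrite gerBl exprn_ge0.
elim: N => [|N IHN]; first by rewrite big_ord0 expr0 subrr.
by rewrite big_ord_recr /= IHN exprS; field.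
Qed.

(** * Coefficient functions *)

Section essentially_bounded_theory.
Context {R : realType} {d : nat} (D : set 'rV[R]_d.+1).
Implicit Types (k : 'rV[R]_d.+1 -> R) (B : R).

Definition measurable_on k : Prop :=
  measurable_fun (D : set (lebesgue_space R d)) (k : lebesgue_space R d -> R).

(** [fine] sends [-oo] to [0], hence the hypothesis [0 <= M]. *)
Lemma fine_ess_sup_on_le k (M : R) : 0 <= M -> (ess_sup_on D k <= M%:E)%E ->
  fine (ess_sup_on D k) <= M.
Proof. by move=> M0; case: (ess_sup_on D k). Qed.

Lemma ess_sup_on_le k (M : R) : (forall x, D x -> k x <= M) ->
  (ess_sup_on D k <= M%:E)%E.
Proof.
move=> kM; apply/ess_supP; apply: nearW => x; rewrite /patch.
by case: ifPn => [/set_mem/kM|_]; rewrite ?lee_fin ?leNye.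
Qed.

Lemma bounded_Linfty k (M : R) : measurable_on k ->
  (forall x, D x -> `|k x| <= M) -> Linfty D k.
Proof.
by move=> mk kM; split => //; apply: le_lt_trans (ess_sup_on_le kM) (ltry _).
Qed.

Lemma measurable_onD k k' : measurable_on k -> measurable_on k' ->
  measurable_on (fun x => k x + k' x).
Proof. exact: measurable_funD. Qed.

Lemma measurable_onZ c k : measurable_on k -> measurable_on (fun x => c * k x).
Proof. by move=> mk; apply: measurable_funM => //; exact: measurable_cst. Qed.

Lemma measurable_on_norm k : measurable_on k -> measurable_on (fun x => `|k x|).
Proof. by move=> mk; apply: (measurableT_comp (@normr_measurable R setT)). Qed.

Lemma measurable_on_sum N (k : nat -> 'rV[R]_d.+1 -> R) :
  (forall j, measurable_on (k j)) -> measurable_on (fun x => \sum_(j < N) k j x).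
Proof.
move=> mk; elim: N => [|N IHN].
  rewrite (_ : (fun x => _) = cst 0); first exact: measurable_cst.
  by apply/funext => x; rewrite big_ord0.
rewrite (_ : (fun x => _) = (fun x => \sum_(j < N) k j x + k N x)).
  exact: measurable_onD.
by apply/funext => x; rewrite big_ord_recr.
Qed.

(* The norm of [K] only bounds [ev k] almost everywhere on [D], whereas coercivity
   needs pointwise bounds: [ev k] is replaced by its truncation, which is equal to
   it almost everywhere. *)
Definition truncate (B : R) k x := Num.max (- B) (Num.min B (k x)).

Lemma measurable_on_truncate B k : measurable_on k -> measurable_on (truncate B k).
Proof.
move=> mk; apply: measurable_maxr; first exact: measurable_cst.
by apply: measurable_minr => //; exact: measurable_cst.
Qed.

Lemma truncate_id B k x : `|k x| <= B -> truncate B k x = k x.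
Proof.
by rewrite ler_norml /truncate => /andP[k1 k2]; rewrite min_r// max_r.
Qed.

Lemma norm_truncate_le B k x : 0 <= B -> `|truncate B k x| <= B.
Proof.
move=> B0; rewrite /truncate ler_norml le_max lexx /= ge_max ge_min lexx /= andbT.
by rewrite (le_trans _ B0)// oppr_le0.
Qed.

Lemma norm_truncate_le_norm B k x : 0 <= B -> `|truncate B k x| <= `|k x|.
Proof.
move=> B0; have [kB|/ltW Bk] := leP `|k x| B; first by rewrite truncate_id.
exact: le_trans (norm_truncate_le _ _ B0) Bk.
Qed.

(** The difference is written [- 1 * _ + _] to match the form in which [a1] is assumed linear in its
    coefficient. *)
Lemma ess_sup_on_truncate B k : (ess_sup_on D (fun x => `|k x|)%R <= B%:E)%E ->
  (ess_sup_on D (fun x => `|- 1 * truncate B k x + k x|)%R <= 0%:E)%E.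
Proof.
move=> /ess_supP kB; apply/ess_supP; apply: filterS kB => x; rewrite /patch.
case: ifPn => [_|_]; last by move=> _; exact: leNye.
by rewrite !lee_fin => /truncate_id ->; rewrite mulN1r addNr normr0.
Qed.

End essentially_bounded_theory.

Section affine_coef_theory.
Context {R : realType} {T : Type} (D : set T) (k0 : T -> R) (k : nat -> T -> R).
Hypothesis k_cvg : forall x y, D x -> cube y -> cvgn (series (fun j => y j * k j x)).

Lemma limn_series_finite (a : nat -> R) N : (forall j, (N <= j)%N -> a j = 0) ->
  limn (series a) = \sum_(j < N) a j.
Proof.
move=> a0; apply: lim_near_cst => //; near=> n.
have Nn : (N <= n)%N by near: n; exact: nbhs_infty_ge.
rewrite /series /= (big_cat_nat _ Nn)//= big_mkord [X in _ + X]big_nat_cond.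
by rewrite [X in _ + X]big1 ?addr0// => j /andP[/andP[/a0]].
Unshelve. all: by end_near. Qed.

Lemma affine_coef_finite y N x : (forall j, (N <= j)%N -> y j = 0) ->
  affine_coef k0 k y x = k0 x + \sum_(j < N) y j * k j x.
Proof.
move=> y0; rewrite /affine_coef (limn_series_finite (N := N))// => j /y0 ->.
by rewrite mul0r.
Qed.

Lemma affine_coef0 : affine_coef k0 k (fun=> 0) = k0.
Proof. by apply/funext => x; rewrite (affine_coef_finite (N := 0))// big_ord0 addr0. Qed.

Lemma affine_coef_with y (j : nat) (t : R) x : D x -> cube y -> -1 <= t <= 1 ->
  affine_coef k0 k [eta y with j |-> t] x = (t - y j) * k j x + affine_coef k0 k y x.
Proof.
move=> Dx yc t1; rewrite /affine_coef addrCA; congr (_ + _).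
pose a i : R := if i == j then (t - y j) * k j x else 0.
have lim_a : limn (series a) = (t - y j) * k j x.
  rewrite (limn_series_finite (N := j.+1)); last first.
    by move=> i; rewrite /a; case: eqP => // ->; rewrite ltnn.
  rewrite (bigD1 ord_max)//= {1}/a eqxx big1 ?addr0// => i.
  by rewrite /a -val_eqE /= => /negPf ->.
have cvg_a : cvgn (series a).
  apply: (is_cvg_near_cst ((t - y j) * k j x)); near=> n.
  have jn : (j < n)%N by near: n; exact: nbhs_infty_gt.
  rewrite /series /= big_mkord (bigD1 (Ordinal jn))//= {1}/a eqxx big1 ?addr0// => i.
  by rewrite /a -val_eqE /= => /negPf ->.
rewrite -lim_a -limD//; last exact: k_cvg.
congr (limn _); apply/funext => n; rewrite /series /= fctE -big_split /=.
apply: eq_bigr => i _; rewrite /a /=; case: eqP => [->|_]; last by rewrite add0r.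
by rewrite -mulrDl subrK.
Unshelve. all: by end_near. Qed.

(** Take the parameters [c * Num.sg (k j x)] for [j < N] and [0] beyond, with [c = 1] and [c = - 1]:
    the affine coefficient then becomes [k0 x] plus or minus the sum of absolute values. *)
Lemma affine_coef_bounds (lo hi : R) :
  (forall x y, D x -> cube y -> lo <= affine_coef k0 k y x <= hi) ->
  forall N x, D x -> \sum_(j < N) `|k j x| <= k0 x - lo /\
    k0 x + \sum_(j < N) `|k j x| <= hi.
Proof.
move=> bnd N x Dx.
pose y (c : R) j : R := if (j < N)%N then c * Num.sg (k j x) else 0.
have yc (c : R) : `|c| = 1 -> cube (y c).
  move=> c1 j; rewrite -ler_norml /y; case: ifP => _; last by rewrite normr0.
  by rewrite normrM c1 mul1r normr_sg lern1 leq_b1.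
have yE c : affine_coef k0 k (y c) x = k0 x + c * \sum_(j < N) `|k j x|.
  rewrite (affine_coef_finite (N := N)) => [|j]; last by rewrite /y leqNgt => /negPf ->.
  congr (_ + _); rewrite mulr_sumr; apply: eq_bigr => j _.
  by rewrite /y ltn_ord -mulrA -normrEsg.
have := bnd x _ Dx (yc 1 (normr1 _)); have := bnd x _ Dx (yc (- 1) (normrN1 _)).
by rewrite !yE mulN1r mul1r => /andP[? ?] /andP[? ?]; split; lra.
Qed.

End affine_coef_theory.

Lemma measurable_on_affine_coef (R : realType) (d : nat) (D : set 'rV[R]_d.+1)
    (k0 : 'rV[R]_d.+1 -> R) (k : nat -> 'rV[R]_d.+1 -> R) (y : nat -> R) :
  (forall x, D x -> cvgn (series (fun j => y j * k j x))) ->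
  measurable_on D k0 -> (forall j, measurable_on D (k j)) ->
  measurable_on D (affine_coef k0 k y).
Proof.
move=> k_cvg mk0 mk; apply: measurable_onD => //.
apply: (@measurable_fun_cvg _ (lebesgue_space R d) R D (fun n x => \sum_(j < n) y j * k j x)).
  move=> n; apply: (@measurable_on_sum _ _ _ n (fun j x => y j * k j x)) => j.
  exact: measurable_onZ.
move=> x Dx; under eq_fun do rewrite -(big_mkord xpredT (fun j => y j * k j x)).
exact: k_cvg.
Qed.

Lemma bilinear_bilinear_for (R : realType) (U W : lmodType R)
    (F : {bilinear U -> W -> R | *%R & *%R}) : bilinear_for *%R *%R F.
Proof. by split => [w c u u'|u c w w']; rewrite ?linearPl ?linearPr. Qed.

Section coefficient_form.
Context {R : realType} {d : nat} {D : set 'rV[R]_d.+1} {V : normedModType R}.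
Context (a1 : ('rV[R]_d.+1 -> R) -> V -> V -> R) (C1 : R).
Hypothesis C1_ge0 : 0 <= C1.
Hypothesis a1_bilinear : forall k, Linfty D k -> bilinear_for *%R *%R (a1 k).
Hypothesis a1_linear : forall c k k' w v, Linfty D k -> Linfty D k' ->
    a1 (fun x => c * k x + k' x) w v = c * a1 k w v + a1 k' w v.
Hypothesis a1_bounded : forall k w v, Linfty D k ->
    a1 k w v <= C1 * fine (ess_sup_on D (fun x => `|k x|)) * `|w| * `|v|.

Lemma coefficient_form_bound k (M : R) w v : Linfty D k -> 0 <= M ->
  (ess_sup_on D (fun x => `|k x|)%R <= M%:E)%E ->
  a1 k w v <= C1 * M * `|w| * `|v|.
Proof.
move=> kL M0 kM; apply: le_trans (a1_bounded w v kL) _.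
by rewrite !ler_wpM2r// ler_wpM2l// fine_ess_sup_on_le.
Qed.

(** At the difference of the coefficients [a1] is at most [0] for both [w] and [- w], so it
    vanishes. Thus [a1] depends only on classes in L^oo(D), which justifies truncating. *)
Lemma coefficient_form_ae_eq k k' w v : Linfty D k -> Linfty D k' ->
  (ess_sup_on D (fun x => `|- 1 * k' x + k x|)%R <= 0%:E)%E ->
  a1 k w v = a1 k' w v.
Proof.
move=> kL k'L kk'.
have diffL : Linfty D (fun x => - 1 * k' x + k x).
  split; last exact: le_lt_trans kk' (ltry _).
  by apply: measurable_onD; [apply: measurable_onZ; exact: k'L.1|exact: kL.1].
have le0 z : a1 (fun x => - 1 * k' x + k x) z v <= 0.
  by have := coefficient_form_bound z v diffL (lexx 0) kk'; rewrite mulr0 !mul0r.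
have := le0 w; have := le0 (- w); rewrite (bilinear_forNl (a1_bilinear diffL)).
by rewrite !a1_linear//; lra.
Qed.

Lemma coefficient_form_eq k k' w v : Linfty D k -> Linfty D k' ->
  (forall x, D x -> k x = k' x) -> a1 k w v = a1 k' w v.
Proof.
move=> kL k'L kk'; apply: coefficient_form_ae_eq => //; apply: ess_sup_on_le => x Dx.
by rewrite kk'// mulN1r addNr normr0.
Qed.

Lemma coefficient_form_sum N (c M : nat -> R) (k : nat -> 'rV[R]_d.+1 -> R) w v :
  (forall j, measurable_on D (k j)) -> (forall j x, D x -> `|k j x| <= M j) ->
  Linfty D (fun x => \sum_(j < N) c j * k j x) /\
  a1 (fun x => \sum_(j < N) c j * k j x) w v = \sum_(j < N) c j * a1 (k j) w v.
Proof.
move=> mk kM.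
have sumL n : Linfty D (fun x => \sum_(j < n) c j * k j x).
  apply: (@bounded_Linfty _ _ _ _ (\sum_(j < n) `|c j| * M j)).
    apply: (@measurable_on_sum _ _ _ n (fun j x => c j * k j x)) => j.
    exact: measurable_onZ.
  move=> x Dx; apply: le_trans (ler_norm_sum _ _ _) _; apply: ler_sum => j _.
  by rewrite normrM ler_wpM2l// kM.
have kL j : Linfty D (k j) by apply: bounded_Linfty (kM j).
split=> //; elim: N => [|N IHN].
  rewrite big_ord0.
  have -> : (fun x : 'rV[R]_d.+1 => \sum_(j < 0) c j * k j x) = (fun=> 0).
    by apply/funext => x; rewrite big_ord0.
  have zL : Linfty D (fun=> 0 : R).
    by apply: (@bounded_Linfty _ _ _ _ 0) => [|x _]; [exact: measurable_cst|rewrite normr0].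
  (* For the zero coefficient linearity says that the value of [a1] equals its own double. *)
  have := a1_linear 1 w v zL zL; rewrite (_ : (fun x => _) = (fun=> 0)); first lra.
  by apply/funext => x; rewrite mulr0 addr0.
rewrite big_ord_recr /= -IHN addrC -a1_linear//; congr (a1 _ w v).
by apply/funext => x; rewrite big_ord_recr /= addrC.
Qed.

End coefficient_form.

(** * Weighted bounds on the Taylor coefficients *)

Section affine_saddle.
Context {R : realType} {d : nat} {D : set 'rV[R]_d.+1}.
Context {V Q : completeNormedModType R}.
Context (f : V -> R) (g : Q -> R) (b : V -> Q -> R) (a0 : V -> V -> R).
Context (a1 : ('rV[R]_d.+1 -> R) -> V -> V -> R).
Context (k0 : 'rV[R]_d.+1 -> R) (k : nat -> 'rV[R]_d.+1 -> R) (B : nat -> R).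
Context (u : (nat -> R) -> V) (p : (nat -> R) -> Q).
Context (C1 theta Theta gamma delta alpha beta : R).
Hypothesis C1_gt0 : 0 < C1.
Hypothesis theta_gt0 : 0 < theta.
Hypothesis theta_lt : theta < Theta.
Hypothesis gamma_gt0 : 0 < gamma.
Hypothesis alpha_gt0 : 0 < alpha.
Hypothesis beta_gt0 : 0 < beta.
Hypothesis b_bil : bilinear_for *%R *%R b.
Hypothesis a0_bil : bilinear_for *%R *%R a0.
Hypothesis a1_bilinear : forall k, Linfty D k -> bilinear_for *%R *%R (a1 k).
Hypothesis a1_linear : forall c k k' w v, Linfty D k -> Linfty D k' ->
    a1 (fun x => c * k x + k' x) w v = c * a1 k w v + a1 k' w v.
Hypothesis a1_bounded : forall k w v, Linfty D k ->
    a1 k w v <= C1 * fine (ess_sup_on D (fun x => `|k x|)) * `|w| * `|v|.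
Hypothesis a1_young : forall k w v, Linfty D k ->
    a1 k w v <= 2^-1 * (a1 (fun x => `|k x|) w w + a1 (fun x => `|k x|) v v).
Hypothesis a_bounded : forall k w v, Linfty D k ->
    (forall x, D x -> theta <= k x <= Theta) ->
    a0 w v + a1 k w v <= gamma * `|w| * `|v|.
Hypothesis a_coercive : forall k v, Linfty D k ->
    (forall x, D x -> theta <= k x <= Theta) ->
    kernel_form b v -> alpha * `|v| ^+ 2 <= a0 v v + a1 k v v.
Hypothesis b_bounded : forall v q, b v q <= delta * `|v| * `|q|.
Hypothesis b_inf_sup : (beta%:E <= inf_sup b)%E.
Hypothesis k0_meas : measurable_on D k0.
Hypothesis k_meas : forall j, measurable_on D (k j).
Hypothesis k_cvg : forall x y, D x -> cube y ->
  cvgn (series (fun j => y j * k j x)).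
Hypothesis k_bounds : forall x y, D x -> cube y ->
  theta <= affine_coef k0 k y x <= Theta.
Hypothesis B_gt0 : forall j, 0 < B j.
Hypothesis k_ess : forall j, (ess_sup_on D (fun x => `|k j x|)%R <= (B j)%:E)%E.

Let A y w v := a0 w v + a1 (affine_coef k0 k y) w v.

Hypothesis solution : forall y, cube y -> saddle_solution (A y) b f g (u y) (p y).

Let open_cube_cube (y : nat -> R) : open_cube y -> cube y.
Proof. by move=> yc j; have /andP[y1 y2] := yc j; rewrite !ltW. Qed.

Let C1_ge0 : 0 <= C1. Proof. exact: ltW. Qed.

Lemma affine_coef_Linfty y : cube y -> Linfty D (affine_coef k0 k y).
Proof.
move=> yc; apply: (@bounded_Linfty _ _ _ _ Theta).
  by apply: measurable_on_affine_coef => // x Dx; exact: k_cvg.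
move=> x Dx; have /andP[lo hi] := k_bounds Dx yc.
by rewrite ger0_norm// (le_trans (ltW theta_gt0)).
Qed.

Let k_sum_bounds := affine_coef_bounds k_bounds.

(** Adding the two inequalities of [affine_coef_bounds] eliminates [k0 x]. *)
Lemma coef_le_Theta j x : D x -> `|k j x| <= Theta.
Proof.
move=> Dx; have [H1 H2] := k_sum_bounds j.+1 Dx.
rewrite big_ord_recr /= in H1 H2.
have S0 : 0 <= \sum_(i < j) `|k i x| by apply: sumr_ge0.
by have := normr_ge0 (k j x); move: theta_gt0 H1 H2 S0; lra.
Qed.

Lemma coef_Linfty j : Linfty D (k j).
Proof. by apply: bounded_Linfty (@coef_le_Theta j). Qed.

Lemma affine_form_bil y : cube y -> bilinear_for *%R *%R (A y).
Proof.
move=> yc; have a1b := a1_bilinear (affine_coef_Linfty yc).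
split=> [v c w w'|w c v v']; rewrite /A.
  by rewrite (bilinear_forPl a0_bil) (bilinear_forPl a1b) /= mulrDr addrACA.
by rewrite (bilinear_forPr a0_bil) (bilinear_forPr a1b) /= mulrDr addrACA.
Qed.

Lemma coef_form_bound j w v : a1 (k j) w v <= C1 * B j * `|w| * `|v|.
Proof.
exact: (coefficient_form_bound C1_ge0 a1_bounded _ _ (coef_Linfty j) (ltW (B_gt0 j))).
Qed.

Lemma affine_derivative_equation nu :
  [/\ derivative_equation b A (a1 \o k) f g u p nu,
      derivable_on_cube (mixed_partial nu u) & derivable_on_cube (mixed_partial nu p)].
Proof.
apply: (@derivative_equation_all R V Q b A (a1 \o k) f g u p
  (alpha^-1 + (1 + gamma / alpha) / beta) gamma delta (fun j => C1 * B j)) => //.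
- by move=> y /open_cube_cube; exact: affine_form_bil.
- by move=> j; apply: a1_bilinear; exact: coef_Linfty.
- move=> y j t w v yc /andP[t1 t2].
  have t11 : -1 <= t <= 1 by rewrite !ltW.
  have yc' := open_cube_cube yc.
  have yt : cube [eta y with j |-> t] by move=> i /=; case: eqP.
  rewrite /A /= -addrA; congr (_ + _); rewrite addrC.
  rewrite -a1_linear//; [|exact: coef_Linfty|exact: affine_coef_Linfty].
  (* The formula [affine_coef_with] holds on [D] only, so the two coefficients are compared as
     elements of L^oo(D). *)
  apply: (coefficient_form_eq C1_ge0 a1_bilinear a1_linear a1_bounded).
  + exact: affine_coef_Linfty.
  + apply: (@bounded_Linfty _ _ _ _ Theta).
      apply: measurable_onD; last exact: (affine_coef_Linfty yc').1.
      exact: measurable_onZ.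
    move=> x Dx; rewrite -(affine_coef_with k0 k_cvg j Dx yc' t11).
    have /andP[lo hi] := k_bounds Dx yt.
    by rewrite ger0_norm// (le_trans (ltW theta_gt0)).
  + by move=> x Dx; exact: (affine_coef_with k0 k_cvg j Dx yc' t11).
- by rewrite addr_ge0 ?divr_ge0 ?addr_ge0 ?divr_ge0 ?invr_ge0 ?(ltW alpha_gt0)
    ?(ltW gamma_gt0) ?(ltW beta_gt0).
- by move=> j; rewrite mulr_ge0// ltW.
- move=> y w v /open_cube_cube yc; apply: a_bounded => [|x Dx]; last exact: k_bounds.
  exact: affine_coef_Linfty.
- by move=> j w v; exact: coef_form_bound.
- move=> y /open_cube_cube yc; apply: coercive_saddle_stable => //.
  + exact: affine_form_bil.
  + move=> v; apply: a_coercive => [|x Dx]; last exact: k_bounds.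
    exact: affine_coef_Linfty.
  + move=> w v; apply: a_bounded => [|x Dx]; last exact: k_bounds.
    exact: affine_coef_Linfty.
- by move=> y /open_cube_cube; exact: solution.
Qed.

Section weighted_bounds.
Context (rho : nat -> R) (SB : R).
Hypothesis rho_ge0 : forall j, 0 <= rho j.
(** Stated for truncated coefficients: weights inversely proportional to [B j] call for [B j] as a
    bound at every point of [D]. *)
Hypothesis budget : forall N x, D x ->
  \sum_(j < N) rho j * `|truncate (B j) (k j) x| <= k0 x - theta.
Hypothesis rho_sum : forall N, \sum_(j < N) rho j * B j <= SB.

Local Notation t := (taylor_coef u).
Local Notation tp := (taylor_coef p).
Local Notation ktr := (fun j x => truncate (B j) (k j) x).
Local Notation kabs := (fun j x => `|truncate (B j) (k j) x|).

(** It does not involve [rho], so the weights may vary with the index. With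
    [c = C1 * Theta / alpha], the energy estimate bounds the square by [c / 2 * |u(0)|^2], and
    [c / 2 <= (1 + c)^2]; the summand [1] covers index zero. *)
Definition taylor_bound : R := (1 + C1 * Theta / alpha) * `|u (fun=> 0)|.

Definition taylor_multiplier_bound : R :=
  `|p (fun=> 0)| + (C1 * SB + gamma) * taylor_bound / beta.

Let cube0 : cube (fun=> 0 : R). Proof. by move=> j; rewrite oppr_le0 ler01. Qed.

Let k0_Linfty : Linfty D k0.
Proof. by rewrite -(affine_coef0 k0 k); exact: affine_coef_Linfty. Qed.

Let ktr_meas j : measurable_on D (ktr j).
Proof. exact: measurable_on_truncate. Qed.

Let kabs_le j x : D x -> `|kabs j x| <= B j.
Proof. by move=> _; rewrite normr_id norm_truncate_le// ltW. Qed.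

Let ktr_Linfty j : Linfty D (ktr j).
Proof.
by apply: (@bounded_Linfty _ _ _ _ (B j)) => // x _; rewrite norm_truncate_le// ltW.
Qed.

Let kabs_Linfty j : Linfty D (kabs j).
Proof.
by apply: (@bounded_Linfty _ _ _ _ (B j)) (kabs_le j); exact: measurable_on_norm.
Qed.

Lemma coef_form_truncate j w v : a1 (k j) w v = a1 (ktr j) w v.
Proof.
apply: (coefficient_form_ae_eq C1_ge0 a1_bilinear a1_linear a1_bounded) => //.
  exact: coef_Linfty.
exact: ess_sup_on_truncate.
Qed.

Let taylor_equation nu N : supp_below N nu ->
  (forall v, A (fun=> 0) (t nu) v + b v (tp nu) =
     (if nu == index_zero then f v else 0)
     - \sum_(j < N | (0 < nu j)%N) a1 (k j) (t (dec_index j nu)) v) /\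
  (forall q, b (t nu) q = if nu == index_zero then g q else 0).
Proof.
have [eq_nu _ _] := affine_derivative_equation nu.
apply: taylor_coef_equation eq_nu => //; first exact: affine_form_bil.
by move=> j; apply: a1_bilinear; exact: coef_Linfty.
Qed.

Let taylor_kernel nu : nu != index_zero -> kernel_form b (t nu).
Proof.
by move=> nu0 q; have [N nuN] := supp_belowP nu; rewrite (taylor_equation nuN).2 (negPf nu0).
Qed.

Let taylor_coef0 (W : normedModType R) (psi : (nat -> R) -> W) :
  taylor_coef psi index_zero = psi (fun=> 0).
Proof.
by rewrite /taylor_coef /multi_fact finsupp0 big_nil invr1 scale1r mixed_partial0.
Qed.

Lemma taylor_coef_energy nu : nu != index_zero ->
  alpha * (index_weight rho nu * `|t nu|) ^+ 2 <= C1 * Theta * `|u (fun=> 0)| ^+ 2 / 2.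
Proof.
apply: (@weighted_energy_estimate R V t (A (fun=> 0)) (a1 \o k)
  (fun j w => a1 (kabs j) w w) rho alpha (C1 * Theta * `|u (fun=> 0)| ^+ 2)) => //.
- by move=> j; apply: a1_bilinear; exact: coef_Linfty.
- move=> mu N mu0 muN; have := (taylor_equation muN).1 (t mu).
  by rewrite (taylor_kernel mu0) addr0 (negPf mu0) sub0r.
- move=> j w v; rewrite /= coef_form_truncate -(bilinear_forNl (a1_bilinear (ktr_Linfty j))).
  apply: le_trans (a1_young _ _ (ktr_Linfty j)) _.
  have ab := a1_bilinear (kabs_Linfty j).
  by rewrite (bilinear_forNl ab) (bilinear_forNr ab) opprK.
(* Young's inequality for the pair [- w], [w] forces the diagonal values of [a1] to be nonnegative,
   even for [w] outside the kernel of [b]. *)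
- move=> j w; have ab := a1_bilinear (kabs_Linfty j).
  have := a1_young (- w) w (kabs_Linfty j).
  rewrite (_ : (fun x => `|kabs j x|) = kabs j); last first.
    by apply/funext => x; rewrite normr_id.
  by rewrite !(bilinear_forNl ab) (bilinear_forNr ab); lra.
- move=> j c w; have ab := a1_bilinear (kabs_Linfty j).
  by rewrite (bilinear_forZl ab) (bilinear_forZr ab) mulrA.
- exact: ltW.
- move=> mu N mu0.
  have [SL SE] := coefficient_form_sum a1_linear N rho (t mu) (t mu)
    (fun j => (kabs_Linfty j).1) kabs_le.
  (* Coercivity is applied to this coefficient, [k0] minus the weighted sum: the budget keeps it
     above [theta], and [k0 <= Theta] bounds it from above. *)
  have diffL : Linfty D (fun x => - 1 * (\sum_(j < N) rho j * kabs j x) + k0 x).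
    apply: (@bounded_Linfty _ _ _ _ Theta).
      by apply: measurable_onD => //; apply: measurable_onZ; exact: SL.1.
    move=> x Dx; have [H1 H2] := k_sum_bounds 0%N Dx.
    rewrite big_ord0 addr0 in H1 H2; have := budget N Dx.
    have : 0 <= \sum_(j < N) rho j * kabs j x.
      by apply: sumr_ge0 => j _; rewrite mulr_ge0.
    by move: theta_gt0 theta_lt H1 H2 => *; rewrite ler_norml; apply/andP; split; lra.
  have := a_coercive (v := t mu) diffL _ (taylor_kernel mu0).
  rewrite a1_linear// SE /A affine_coef0 => coer.
  rewrite -lerBrDr; apply: le_trans (coer _) _; last by lra.
  move=> x Dx; have [H1 H2] := k_sum_bounds 0%N Dx.
  rewrite big_ord0 addr0 in H1 H2; have := budget N Dx.
  have : 0 <= \sum_(j < N) rho j * kabs j x.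
    by apply: sumr_ge0 => j _; rewrite mulr_ge0.
  by move=> *; apply/andP; split; lra.
- move=> N; rewrite taylor_coef0.
  have [SL SE] := coefficient_form_sum a1_linear N rho (u (fun=> 0)) (u (fun=> 0))
    (fun j => (kabs_Linfty j).1) kabs_le.
  rewrite -SE expr2 mulrA.
  apply: (coefficient_form_bound C1_ge0 a1_bounded) => //.
    by rewrite (le_trans (ltW theta_gt0))// ltW.
  apply: ess_sup_on_le => x Dx; have [H1 H2] := k_sum_bounds 0%N Dx.
  rewrite big_ord0 addr0 in H1 H2; have := budget N Dx.
  rewrite ger0_norm; first by move: theta_gt0; lra.
  by apply: sumr_ge0 => j _; rewrite mulr_ge0.
Qed.

Lemma taylor_coef_weighted_bound nu :
  index_weight rho nu * `|t nu| <= taylor_bound.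
Proof.
have W_ge0 : 0 <= index_weight rho nu by exact: index_weight_ge0.
have Theta_gt0 : 0 < Theta by exact: lt_trans theta_lt.
have c_ge0 : 0 <= C1 * Theta / alpha by rewrite divr_ge0 ?mulr_ge0 ?ltW.
have [->|nu0] := eqVneq nu index_zero.
  by rewrite index_weight0 mul1r taylor_coef0 ler_peMl// lerDl.
rewrite -(@ler_pXn2r _ 2)// ?nnegrE ?mulr_ge0 ?addr_ge0//.
have := taylor_coef_energy nu0; rewrite mulrC -ler_pdivlMr// => /le_trans; apply.
have -> : C1 * Theta * `|u (fun=> 0)| ^+ 2 / 2 / alpha =
  C1 * Theta / alpha / 2 * `|u (fun=> 0)| ^+ 2 by field; rewrite gt_eqF.
rewrite /taylor_bound exprMn ler_wpM2r ?sqr_ge0//.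
by move: c_ge0; set c := C1 * Theta / alpha => c_ge0; nra.
Qed.

(** The inf-sup condition bounds [tp nu] by the other terms of its equation. The coupling to a
    predecessor brings a factor [rho j] from the weight and [C1 * B j] from the form, so all
    couplings together cost [C1 * SB] times [taylor_bound]. *)
Lemma taylor_multiplier_weighted_bound nu :
  index_weight rho nu * `|tp nu| <= taylor_multiplier_bound.
Proof.
have W_ge0 : 0 <= index_weight rho nu by exact: index_weight_ge0.
have tb_ge0 : 0 <= taylor_bound.
  by apply: le_trans (taylor_coef_weighted_bound index_zero); rewrite index_weight0 mul1r.
have SB_ge0 : 0 <= SB by have := rho_sum 0; rewrite big_ord0.
have quot_ge0 : 0 <= (C1 * SB + gamma) * taylor_bound / beta.
  apply: divr_ge0; last exact: ltW.
  by apply: mulr_ge0 => //; apply: addr_ge0; [exact: mulr_ge0|exact: ltW].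
have [->|nu0] := eqVneq nu index_zero.
  by rewrite index_weight0 mul1r taylor_coef0 lerDl.
have [N nuN] := supp_belowP nu; have [E _] := taylor_equation nuN.
have A0_bnd w v : A (fun=> 0) w v <= gamma * `|w| * `|v|.
  rewrite /A; apply: a_bounded => [|x Dx]; last exact: k_bounds.
  exact: affine_coef_Linfty.
have CB_ge0 (j : nat) : 0 <= C1 * B j by rewrite mulr_ge0 ?(ltW (B_gt0 j)).
pose M := \sum_(j < N | (0 < nu j)%N) C1 * B j * `|t (dec_index j nu)| + gamma * `|t nu|.
have M_ge0 : 0 <= M.
  rewrite /M addr_ge0 ?mulr_ge0 ?(ltW gamma_gt0)//.
  by apply: sumr_ge0 => j _; rewrite mulr_ge0.
have tp_le : beta * `|tp nu| <= M.
  apply: (@inf_sup_le R V Q b) => // v.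
  have := E v; rewrite (negPf nu0) sub0r => Ev.
  have -> : b v (tp nu) = \sum_(j < N | (0 < nu j)%N)
      a1 (k j) (- t (dec_index j nu)) v + A (fun=> 0) (- t nu) v.
    rewrite (bilinear_forNl (affine_form_bil cube0)).
    under eq_bigr => j _ do rewrite (bilinear_forNl (a1_bilinear (coef_Linfty j))).
    by rewrite sumrN -Ev; ring.
  rewrite /M mulrDl mulr_suml lerD//.
    by apply: ler_sum => j _; rewrite -[ `|t _|]normrN; exact: coef_form_bound.
  by rewrite -[ `|t _|]normrN.
have WM : index_weight rho nu * M <= (C1 * SB + gamma) * taylor_bound.
  rewrite /M mulrDr mulrDl lerD//; last first.
    by rewrite mulrCA ler_wpM2l ?(ltW gamma_gt0)// taylor_coef_weighted_bound.
  apply: (@le_trans _ _ (\sum_(j < N) C1 * taylor_bound * (rho j * B j))).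
    rewrite mulr_sumr big_mkcond; apply: ler_sum => j _ /=.
    case: ifP => [nuj|_]; last first.
      by apply: mulr_ge0; apply: mulr_ge0 => //; exact: ltW.
    rewrite (index_weight_dec rho nuj).
    have := taylor_coef_weighted_bound (dec_index j nu).
    have rB : 0 <= C1 * (rho j * B j).
      by apply: mulr_ge0 => //; apply: mulr_ge0 => //; exact: ltW.
    by move=> /(ler_wpM2l rB); lra.
  by rewrite -mulr_sumr mulrAC ler_wpM2r// ler_wpM2l// rho_sum.
apply: le_trans (ler_wpDl (normr_ge0 (p (fun=> 0))) (lexx _)).
rewrite ler_pdivlMr// -mulrA [_ * beta]mulrC.
by apply: le_trans WM; rewrite ler_wpM2l.
Qed.

End weighted_bounds.
End affine_saddle.

(** * Choice of the weights and summability of the Taylor coefficients *)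

Theorem lemma3p4 (R : realType) (d : nat) (D : set 'rV[R]_d.+1)
  (D_nonempty : D !=set0) (D_open : open D) (D_connected : connected D)
  (D_bounded : bounded_set D)
  (V Q : completeNormedModType R)
  (dotV : {dot V for idfun}) (dotVE : forall v, dotV v v = `|v| ^+ 2)
  (dotQ : {dot Q for idfun}) (dotQE : forall q, dotQ q q = `|q| ^+ 2)
  (f : {scalar V}) (f_cont : continuous (f : V -> R))
  (g : {scalar Q}) (g_cont : continuous (g : Q -> R))
  (K : completeNormedModType R) (ev : K -> 'rV[R]_d.+1 -> R)
  (K_separable : exists S : set K, countable S /\ dense S)
  (ev_linear : forall c k k' x, D x -> ev (c *: k + k') x = c * ev k x + ev k' x)
  (ev_inj : forall k k', (forall x, D x -> ev k x = ev k' x) -> k = k')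
  (ev_Linfty : forall k, Linfty D (ev k))
  (ev_bound : forall k, (ess_sup_on D (fun x => `|ev k x|)%R <= `|k|%:E)%E)
  (b : {bilinear V -> Q -> R | *%R & *%R})
  (a0 : {bilinear V -> V -> R | *%R & *%R})
  (a1 : ('rV[R]_d.+1 -> R) -> V -> V -> R)
  (a1_bilinear : forall k, Linfty D k -> bilinear_for *%R *%R (a1 k))
  (a1_linear : forall c k k' w v, Linfty D k -> Linfty D k' ->
    a1 (fun x => c * k x + k' x) w v = c * a1 k w v + a1 k' w v)
  (c1 C1 : R) (c1_gt0 : 0 < c1) (C1_gt0 : 0 < C1)
  (a1_coercive : forall k v, Linfty D k -> (forall x, D x -> 0 <= k x) ->
    kernel_form b v -> c1 * fine (ess_inf_on D k) * `|v| ^+ 2 <= a1 k v v)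
  (a1_bounded : forall k w v, Linfty D k ->
    a1 k w v <= C1 * fine (ess_sup_on D (fun x => `|k x|)) * `|w| * `|v|)
  (a1_young : forall k w v, Linfty D k ->
    a1 k w v <= 2^-1 * (a1 (fun x => `|k x|) w w + a1 (fun x => `|k x|) v v))
  (theta Theta : R) (theta_gt0 : 0 < theta) (theta_lt : theta < Theta)
  (gamma delta alpha beta : R)
  (gamma_gt0 : 0 < gamma) (delta_gt0 : 0 < delta)
  (alpha_gt0 : 0 < alpha) (beta_gt0 : 0 < beta)
  (a_bounded : forall k w v, Linfty D k ->
    (forall x, D x -> theta <= k x <= Theta) ->
    a0 w v + a1 k w v <= gamma * `|w| * `|v|)
  (a_coercive : forall k v, Linfty D k ->
    (forall x, D x -> theta <= k x <= Theta) ->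
    kernel_form b v -> alpha * `|v| ^+ 2 <= a0 v v + a1 k v v)
  (b_bounded : forall v q, b v q <= delta * `|v| * `|q|)
  (b_inf_sup : (beta%:E <= inf_sup b)%E)
  (kappa0 : K) (kappa : nat -> K)
  (kappa_cvg : forall x y, D x -> cube y ->
    cvgn (series (fun j => y j * ev (kappa j) x)))
  (kmin kmax : \bar R)
  (kminE : kmin = ereal_inf
    [set (affine_coef (ev kappa0) (ev \o kappa) xy.2 xy.1)%:E
    | xy in D `*` cube])
  (kmaxE : kmax = ereal_sup
    [set (affine_coef (ev kappa0) (ev \o kappa) xy.2 xy.1)%:E
    | xy in D `*` cube])
  (theta_lt_kmin : (theta%:E < kmin)%E)
  (kmax_lt_Theta : (kmax < (Theta / 2)%:E)%E)
  (r : R) (theta_lt_r : theta < r) (r_lt_kmin : (r%:E < kmin)%E)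
  (u : (nat -> R) -> V) (p : (nat -> R) -> Q)
  (up_solution : forall y, cube y ->
    saddle_solution
      (fun w v => a0 w v + a1 (affine_coef (ev kappa0) (ev \o kappa) y) w v)
      b f g (u y) (p y))
  (s : R) (s_gt0 : 0 < s) (s_lt1 : s < 1)
  (kappa_summable : (\sum_(0 <= j <oo) (`|kappa j| `^ s)%:E < +oo)%E) :
  has_mixed_partials u /\ has_mixed_partials p /\
  exists rho : nat -> R,
    admissible D (ev kappa0) (ev \o kappa) ((r + theta) / 2) rho /\
    (\esum_(nu in [set: multi_index]) (`|taylor_coef u nu| `^ s)%:E < +oo)%E /\
    (\esum_(nu in [set: multi_index]) (`|taylor_coef p nu| `^ s)%:E < +oo)%E.
Proof.
pose k0 := ev kappa0; pose k := ev \o kappa.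
have Theta_gt0 : 0 < Theta by exact: lt_trans theta_lt.
have b_bil := bilinear_bilinear_for b; have a0_bil := bilinear_bilinear_for a0.
have k0_meas : measurable_on D k0 by case: (ev_Linfty kappa0).
have k_meas j : measurable_on D (k j) by case: (ev_Linfty (kappa j)).
(* The lower bound is [r] rather than [theta]: the gap [r - theta] is what enlarged weights may
   spend. *)
have r_bounds x y : D x -> cube y -> r <= affine_coef k0 k y x <= Theta.
  move=> Dx yc; apply/andP; split; rewrite -lee_fin.
    apply: (le_trans (ltW r_lt_kmin)); rewrite kminE.
    by apply: ereal_inf_lbound; exists (x, y).
  apply: (@le_trans _ _ (Theta / 2)%:E); last by rewrite lee_fin; lra.
  apply: le_trans (ltW kmax_lt_Theta); rewrite kmaxE.
  by apply: ereal_sup_ubound; exists (x, y).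
have k_bounds x y : D x -> cube y -> theta <= affine_coef k0 k y x <= Theta.
  by move=> Dx /(r_bounds x y Dx)/andP[lo ->]; rewrite (le_trans (ltW theta_lt_r)).
have k_sum := affine_coef_bounds r_bounds.
have k_le j x : D x -> `|k j x| <= Theta.
  by move=> Dx; exact: (coef_le_Theta theta_gt0 k_bounds).
have [S kS] : exists S : R, forall N, \sum_(j < N) `|kappa j| `^ s <= S.
  exists (fine (\sum_(0 <= j <oo) (`|kappa j| `^ s)%:E)%E) => N.
  rewrite -lee_fin fineK; last first.
    rewrite ge0_fin_numE//; apply: nneseries_ge0 => j _ _; rewrite lee_fin.
    exact: powR_ge0.
  rewrite -sumEFin -(big_mkord xpredT (fun j => (`|kappa j| `^ s)%:E)).
  by apply: nneseries_lim_ge => j _ _; rewrite lee_fin powR_ge0.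
(* The summand [2^-1 ^+ j.+1] keeps [B j] positive when [kappa j = 0]. *)
pose B j : R := (`|kappa j| `^ s + 2^-1 ^+ j.+1) `^ s^-1.
have Bs_gt0 j : 0 < `|kappa j| `^ s + 2^-1 ^+ j.+1.
  by rewrite ltr_wpDl ?powR_ge0// exprn_gt0.
have B_gt0 j : 0 < B j by exact: powR_gt0.
have BsE j : B j `^ s = `|kappa j| `^ s + 2^-1 ^+ j.+1.
  by rewrite -powRrM mulVf ?gt_eqF// powRr1// ltW.
have k_ess j : (ess_sup_on D (fun x => `|k j x|)%R <= (B j)%:E)%E.
  apply: le_trans (ev_bound (kappa j)) _; rewrite lee_fin.
  have {1}-> : `|kappa j| = (`|kappa j| `^ s) `^ s^-1.
    by rewrite -powRrM mulfV ?gt_eqF// powRr1.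
  rewrite ge0_ler_powR ?invr_ge0 ?nnegrE ?powR_ge0 ?(ltW s_gt0) ?(ltW (Bs_gt0 j))//.
  by rewrite lerDl exprn_ge0.
have bounds := taylor_multiplier_weighted_bound C1_gt0 theta_gt0 theta_lt
  gamma_gt0 alpha_gt0 beta_gt0 b_bil a0_bil a1_bilinear a1_linear a1_bounded
  a1_young a_bounded a_coercive b_bounded b_inf_sup k0_meas k_meas kappa_cvg
  k_bounds B_gt0 k_ess up_solution.
have bounds_u := taylor_coef_weighted_bound C1_gt0 theta_gt0 theta_lt
  gamma_gt0 alpha_gt0 beta_gt0 b_bil a0_bil a1_bilinear a1_linear a1_bounded
  a1_young a_bounded a_coercive b_bounded b_inf_sup k0_meas k_meas kappa_cvg
  k_bounds B_gt0 k_ess up_solution.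
have eqs := affine_derivative_equation C1_gt0 theta_gt0
  gamma_gt0 alpha_gt0 beta_gt0 b_bil a0_bil a1_bilinear a1_linear a1_bounded
  a_bounded a_coercive b_bounded b_inf_sup k0_meas k_meas kappa_cvg
  k_bounds B_gt0 k_ess up_solution.
split; first by move=> nu j y yc; have [_ + _] := eqs nu; exact.
split; first by move=> nu j y yc; have [_ _ +] := eqs nu; exact.
(* Admissibility leaves [(r + theta) / 2 - r = - c], so the sequence [rho] of the statement may
   spend [c]. The weights used for summation may spend [r - theta = 2 * c]: one [c] on the factor
   [1 + eps] of the head, one on the tail. *)
pose c := (r - theta) / 2.
have c_gt0 : 0 < c by rewrite divr_gt0// subr_gt0.
pose eps := c / Theta.
have eps_gt0 : 0 < eps by exact: divr_gt0.
have epsTheta : eps * Theta = c by rewrite divfK// gt_eqF.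
have k_sum_Theta N x : D x -> \sum_(j < N) `|k j x| <= Theta.
  move=> Dx; have [+ _] := k_sum N x Dx; have [_ +] := k_sum 0%N x Dx.
  by rewrite big_ord0 addr0; move: theta_gt0 theta_lt_r; lra.
have rho_gt1 (j : nat) : 1 < 1 + eps * 2^-1 ^+ j.+1.
  by rewrite ltrDl mulr_gt0// exprn_gt0.
(* The excess over [1] costs at most [eps * Theta = c] times a geometric sum bounded by [1]. *)
exists (fun j => 1 + eps * 2^-1 ^+ j.+1); split.
  split=> [j|x Dx]; first exact: rho_gt1.
  apply: lime_le.
    apply: is_cvg_nneseries => j _ _; rewrite lee_fin mulr_ge0//.
    exact: le_trans ler01 (ltW (rho_gt1 j)).
  apply: nearW => N; rewrite sumEFin lee_fin big_mkord.
  apply: (@le_trans _ _ (\sum_(j < N) `|k j x| + \sum_(j < N) c * 2^-1 ^+ j.+1)).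
    rewrite -big_split /=; apply: ler_sum => j _; rewrite mulrDl mul1r lerD2l.
    have h_ge0 : 0 <= eps * 2^-1 ^+ j.+1 by rewrite mulr_ge0 ?exprn_ge0// ltW.
    by rewrite -epsTheta [leRHS]mulrAC; exact: ler_wpM2l (k_le j x Dx).
  rewrite -mulr_sumr; have [+ _] := k_sum N x Dx.
  have : c * \sum_(j < N) 2^-1 ^+ j.+1 <= c * 1.
    by rewrite ler_wpM2l ?(ltW c_gt0)// sum_half_le1.
  by rewrite mulr1 -/k0 -/k; move: (c * _) => cH; rewrite /c; lra.
(* The reciprocals of the tail values of [base]. Since the [B j ^ s] are summable, so are the
   [z j ^ s], and [J] makes their tail at most [1/2]. *)
pose z j := expR 1 / c * B j.
have z_gt0 j : 0 < z j by rewrite mulr_gt0// divr_gt0// expR_gt0.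
have [J zJ] : exists J, forall N, \sum_(j < N | (J <= j)%N) z j `^ s <= 2^-1.
  apply: (@series_tail_le R (fun j => z j `^ s) ((expR 1 / c) `^ s * (S + 1))) => //.
    by move=> j; exact: powR_ge0.
  have zsE j : z j `^ s = (expR 1 / c) `^ s * (`|kappa j| `^ s + 2^-1 ^+ j.+1).
    by rewrite -BsE -powRM//; [rewrite divr_ge0 ?expR_ge0// ltW|exact: ltW].
  move=> N; under eq_bigr do rewrite zsE.
  rewrite -mulr_sumr ler_wpM2l ?powR_ge0// big_split /=.
  by apply: lerD; [exact: kS|exact: sum_half_le1].
(* Beyond [J] the value is the one for which [expR 1 * base j * B j] is exactly [c], the tail budget
   in [adapted_weight_sum_le]. *)
pose base j := if (j < J)%N then 1 + eps else (z j)^-1.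
have base_gt0 j : 0 < base j.
  by rewrite /base; case: ifP => _; [rewrite addr_gt0|rewrite invr_gt0].
have base_tail j : (J <= j)%N -> expR 1 * base j * B j = c.
  rewrite /base ltnNge => -> /=; rewrite /z; field.
  by rewrite !gt_eqF ?expR_gt0// B_gt0.
(* [SB] does not depend on [nu], so the multiplier bound is uniform although the weights [rho nu]
   are not. *)
pose SB := \sum_(j < J) (1 + eps) * B j + c.
pose rho nu := adapted_weight J base nu.
have rho_ge0 nu j : 0 <= rho nu j by exact: adapted_weight_ge0.
have rho_sum nu N : \sum_(j < N) rho nu j * B j <= SB.
  apply: le_trans (adapted_weight_sum_le nu N (fun j => ltW (base_gt0 j)) (ltW c_gt0) _) _.
    by move=> j /base_tail ->.
  rewrite lerD2r.
  apply: (@le_trans _ _ (\sum_(j < N | (j < J)%N) (1 + eps) * B j)).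
    by apply: ler_sum => j jJ; rewrite /base jJ.
  have B_ge0 j : 0 <= (1 + eps) * B j.
    by rewrite mulr_ge0 ?addr_ge0 ?(ltW eps_gt0) ?(ltW (B_gt0 j)).
  rewrite -(big_mkord (fun j => (j < J)%N) (fun j => (1 + eps) * B j)).
  rewrite -[leRHS](big_mkord xpredT (fun j => (1 + eps) * B j)) -big_filter.
  apply: ler_sum_uniq_sub; [|exact: iota_uniq| |exact: B_ge0].
    by apply: filter_uniq; exact: iota_uniq.
  by move=> j; rewrite mem_filter !mem_index_iota => /andP[].
have budget nu N x : D x ->
    \sum_(j < N) rho nu j * `|truncate (B j) (k j) x| <= k0 x - theta.
  move=> Dx.
  have tr_le j : `|truncate (B j) (k j) x| <= B j by rewrite norm_truncate_le// ltW.
  have tr_le' j : `|truncate (B j) (k j) x| <= `|k j x|.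
    by rewrite norm_truncate_le_norm// ltW.
  apply: le_trans (adapted_weight_sum_le
    (m := fun j => `|truncate (B j) (k j) x|) nu N
    (fun j => ltW (base_gt0 j)) (ltW c_gt0) _) _.
    move=> j /base_tail <-; rewrite ler_wpM2l// mulr_ge0 ?expR_ge0//.
    exact: ltW.
  (* The head costs at most [k0 x - r] plus [c] for the excess [eps], and the tail another [c]: in
     total [k0 x - r + 2 * c = k0 x - theta]. *)
  have : \sum_(j < N | (j < J)%N) base j * `|truncate (B j) (k j) x| <=
      (1 + eps) * \sum_(j < N) `|k j x|.
    rewrite mulr_sumr big_mkcond; apply: ler_sum => j _.
    case: ifP => jJ; last by rewrite mulr_ge0 ?addr_ge0 ?(ltW eps_gt0).
    by rewrite /base jJ ler_wpM2l ?addr_ge0 ?(ltW eps_gt0).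
  have : eps * \sum_(j < N) `|k j x| <= c.
    by rewrite -epsTheta ler_wpM2l ?(ltW eps_gt0)// k_sum_Theta.
  by have [+ _] := k_sum N x Dx; rewrite /c; lra.
have q_lt1 : (1 + eps) `^ (- s) < 1.
  rewrite powRN invf_lt1 ?powR_gt0 ?addr_gt0// -[ltLHS](congr1 (@^~ s) (powR1 R)).
  by rewrite gt0_ltr_powR ?nnegrE ?addr_ge0 ?ltrDl ?(ltW eps_gt0).
have D_tail N : \sum_(j < N | (J <= j)%N) base j `^ (- s) <= 2^-1.
  apply: le_trans (zJ N); rewrite le_eqVlt; apply/orP; left; apply/eqP.
  apply: eq_bigr => j jJ; rewrite /base ltnNge jJ /=.
  by rewrite -powR_inv1 ?(ltW (z_gt0 j))// -powRrM mulN1r opprK.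
(* Each coefficient is bounded with the weight of its own index, by one common [M]. The multinomial
   majorant then has head ratio [(1 + eps)^(-s) < 1] and tail sum at most [1/2]. *)
have summable (W : normedModType R) (t : multi_index -> W) (M : R) :
    (forall nu, index_weight (rho nu) nu * `|t nu| <= M) ->
    (\esum_(nu in [set: multi_index]) (`|t nu| `^ s)%:E < +oo)%E.
  move=> tM.
  have M_ge0 : 0 <= M.
    by apply: le_trans (tM index_zero); rewrite index_weight0 mul1r.
  apply: (@multinomial_summable R J ((1 + eps) `^ (- s)) 2^-1
    (fun j => base j `^ (- s)) _ (M `^ s)) => //.
  - by move=> j; exact: powR_ge0.
  - by move=> j jJ; rewrite /base jJ.
  - by rewrite invf_lt1// ltr1n.
  - exact: powR_ge0.
  - move=> nu; rewrite powR_ge0 /=.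
    by apply: powR_le_multinomial_weight => //; rewrite s_gt0.
split; apply: summable => nu.
  exact: (bounds_u _ (rho_ge0 nu) (budget nu)).
exact: (bounds _ _ (rho_ge0 nu) (budget nu) (rho_sum nu)).
Qed.
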